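(* Let $X$ be a compact connected smooth manifold, possibly with boundary, of dimension $n\ge 2$, and let $\mu$ be a good measure on $X$. Then the set of aperiodic automorphisms is a dense $G_\delta$ of $\mathrm{Auto}(X,\mu)$ for the weak topology.
   Context: $X$ carries a Riemannian metric inducing a distance $\mathrm{dist}$. A good measure on $X$ is a Borel probability measure that has no atoms, is strictly positive on every nonempty open set, and gives measure zero to the boundary of $X$. $\mathrm{Auto}(X,\mu)$ is the set of bi-measurable bijections of $X$ preserving $\mu$, two of them being identified when they coincide almost everywhere. The weak topology on it is given by the distance $d_{\mathit{faible}}(f,g)=\inf\{\alpha\mid\mu\{x\mid\mathrm{dist}(f(x),g(x))>\alpha\}<\alpha\}$. An automorphism is aperiodic if the set of its periodic points has measure zero. *)

(* Defs.v *)
From HB Require Import structures.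
From mathcomp Require Import all_boot all_order all_algebra.
From mathcomp Require Import generic_quotient.
From mathcomp Require Import all_classical all_reals all_analysis.

Set Implicit Arguments.
Unset Strict Implicit.
Unset Printing Implicit Defensive.

Import Order.TTheory GRing.Theory Num.Theory.
Import numFieldNormedType.Exports.

Local Open Scope classical_set_scope.
Local Open Scope ring_scope.

(* Measurable types are pointed in the library, hence this join. *)
#[short(type="pmetricType")]
HB.structure Definition PointedMetric (K : numDomainType) :=
  { M of Metric K M & Pointed M }.

Notation borel X := (g_sigma_algebraType (@open X)).

Section smooth_maps.
Context {R : realType} {V W : normedModType R}.

Definition iter_derive (f : V -> W) (s : seq V) : V -> W :=
  foldr (fun v g => 'D_v g) f s.

(* For V of finite dimension this is the class C^oo on the open set U: all
   iterated directional derivatives exist and are continuous. *)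
Definition smooth_open (U : set V) (f : V -> W) : Prop :=
  forall (s : seq V) (x : V), U x ->
    {for x, continuous (iter_derive f s)} /\
    forall v, derivable (iter_derive f s) x v.

Definition smooth_ext (A : set V) (f : V -> W) (U : set V) (h : V -> W) : Prop :=
  [/\ open U, smooth_open U h & forall y, A y -> U y -> h y = f y].

(* Smoothness on an arbitrary subset: local smooth extendability. *)
Definition smooth_on (A : set V) (f : V -> W) : Prop :=
  forall x, A x -> exists U h, U x /\ smooth_ext A f U h.

End smooth_maps.

Section manifolds.
Context {R : realType} {n : nat}.

(* The constraint bears on the coordinate of index 0 (if n > 0). *)
Definition halfspace : set 'rV[R]_n :=
  [set v | forall i : 'I_n, val i = 0%N -> 0 <= v ord0 i].

Definition halfspace_bd : set 'rV[R]_n :=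
  [set v | exists2 i : 'I_n, val i = 0%N & v ord0 i = 0].

(* [chart_map] and [chart_inv] are total functions, of which only the
   restrictions to [chart_dom] and to its image matter. *)
Record chart (X : topologicalType) := Chart {
  chart_dom : set X ;
  chart_map : X -> 'rV[R]_n ;
  chart_inv : 'rV[R]_n -> X ;
  chart_dom_open : open chart_dom ;
  chart_img_open : exists2 O : set 'rV[R]_n,
    open O & chart_map @` chart_dom = O `&` halfspace ;
  chart_mapK : forall x, chart_dom x -> chart_inv (chart_map x) = x ;
  chart_map_cont : {within chart_dom, continuous chart_map} ;
  chart_inv_cont : {within chart_map @` chart_dom, continuous chart_inv} }.

Definition chart_overlap (X : topologicalType) (c d : chart X) : set 'rV[R]_n :=
  chart_map c @` (chart_dom c `&` chart_dom d).

Definition transition (X : topologicalType) (c d : chart X) :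
  'rV[R]_n -> 'rV[R]_n := chart_map d \o chart_inv c.

Record smooth_manifold (X : topologicalType) := SmoothManifold {
  atlas : set (chart X) ;
  atlas_cover : forall x, exists2 c, atlas c & chart_dom c x ;
  atlas_compat : forall c d, atlas c -> atlas d ->
    smooth_on (chart_overlap c d) (transition c d) }.

Definition boundary (X : topologicalType) (M : smooth_manifold X) : set X :=
  [set x | exists c,
    [/\ atlas M c, chart_dom c x & halfspace_bd (chart_map c x)]].

Definition bilin (G : 'M[R]_n) (v w : 'rV[R]_n) : R :=
  (v *m G *m w^T) ord0 ord0.

(* [gram c x] is the Gram matrix of the metric at x in the chart c. In
   [gram_change], the differential of the transition map at a point that may
   lie on the boundary is that of any smooth extension h. *)
Record riemannian_metric (X : topologicalType) (M : smooth_manifold X) :=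
  RiemannianMetric {
  gram : chart X -> X -> 'M[R]_n ;
  gram_sym : forall c x, atlas M c -> chart_dom c x ->
    forall v w, bilin (gram c x) v w = bilin (gram c x) w v ;
  gram_pos : forall c x, atlas M c -> chart_dom c x ->
    forall v, v != 0 -> 0 < bilin (gram c x) v v ;
  gram_smooth : forall c, atlas M c ->
    smooth_on (chart_map c @` chart_dom c) (gram c \o chart_inv c) ;
  gram_change : forall c d x, atlas M c -> atlas M d ->
    chart_dom c x -> chart_dom d x ->
    forall U h, U (chart_map c x) ->
      smooth_ext (chart_overlap c d) (transition c d) U h ->
    forall v w, bilin (gram c x) v w =
      bilin (gram d x) ('D_v h (chart_map c x)) ('D_w h (chart_map c x)) }.

Section distance.
Context {X : topologicalType} {M : smooth_manifold X} (g : riemannian_metric M).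

Definition smooth_curve (a b : R) (gamma : R -> X) : Prop :=
  forall c, atlas M c ->
    smooth_on (V := R^o) (`[a, b]%classic `&` gamma @^-1` chart_dom c)
      (chart_map c \o gamma).

Definition piecewise_smooth (gamma : R -> X) : Prop :=
  {within `[0, 1], continuous gamma} /\
  exists2 s : seq R, itv_partition 0 1 s &
    forall i, (i < size s)%N ->
      smooth_curve (nth 0 (0 :: s) i) (nth 0 (0 :: s) i.+1) gamma.

Definition chart_at (x : X) : chart X := sval (cid2 (atlas_cover M x)).

(* Independent of the chart chosen at [gamma t], by [gram_change], except
   at the finitely many break points of gamma. *)
Definition speed (gamma : R -> X) (t : R) : R :=
  let c := chart_at (gamma t) in
  let v := derive1 (chart_map c \o gamma) t in
  Num.sqrt (bilin (gram g c (gamma t)) v v).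

Definition curve_length (gamma : R -> X) : \bar R :=
  (\int[lebesgue_measure]_(t in `[0%R, 1%R]) (speed gamma t)%:E)%E.

Definition riemannian_dist (x y : X) : \bar R :=
  ereal_inf [set curve_length gamma | gamma in
    [set gamma | [/\ piecewise_smooth gamma, gamma 0 = x & gamma 1 = y]]].

End distance.

End manifolds.

Arguments chart R n X : clear implicits.
Arguments smooth_manifold R n X : clear implicits.

Section good_measure.
Context {R : realType}.

Definition atomless d (T : measurableType d) (mu : set T -> \bar R) : Prop :=
  forall A, measurable A -> (0 < mu A)%E ->
    exists B, [/\ measurable B, B `<=` A, (0 < mu B)%E & (mu B < mu A)%E].

Definition good_measure (n : nat) (X : pmetricType R)
    (M : smooth_manifold R n X) (mu : probability (borel X) R) : Prop :=
  [/\ atomless mu,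
      forall U : set X, open U -> U !=set0 -> (0 < mu U)%E &
      mu.-negligible (boundary M : set (borel X))].

End good_measure.

Section automorphisms.
Context {R : realType} {X : pmetricType R} (mu : probability (borel X) R).

Record automorphism := Automorphism {
  aut_fun :> borel X -> borel X ;
  aut_bij : bijective aut_fun ;
  aut_meas : measurable_fun setT aut_fun ;
  aut_meas_inv : forall A, measurable A -> measurable (aut_fun @` A) ;
  aut_preserving : forall A, measurable A -> mu (aut_fun @^-1` A) = mu A }.

HB.instance Definition _ := gen_eqMixin automorphism.
HB.instance Definition _ := gen_choiceMixin automorphism.

Definition aut_ae (f g : automorphism) : bool :=
  `[< {ae mu, forall x, f x = g x} >].

Lemma aut_ae_refl : reflexive aut_ae.
Proof. by move=> f; apply/asboolP; apply/aeW. Qed.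

Lemma aut_ae_sym : symmetric aut_ae.
Proof.
by move=> f g; apply/idP/idP => /asboolP fg; apply/asboolP;
  apply: filterS fg => x ->.
Qed.

Lemma aut_ae_trans : transitive aut_ae.
Proof.
move=> g f h /asboolP fg /asboolP gh; apply/asboolP.
by apply: filterS2 fg gh => x -> ->.
Qed.

Canonical aut_ae_equiv :=
  EquivRel aut_ae aut_ae_refl aut_ae_sym aut_ae_trans.

Definition Auto : Type := {eq_quot aut_ae}%qT.

HB.instance Definition _ := EqQuotient.copy Auto {eq_quot aut_ae}%qT.
HB.instance Definition _ := Choice.copy Auto {eq_quot aut_ae}%qT.

(* A null set of points changes neither this infimum nor [aperiodic] below, so
   the representatives chosen by [repr] do not matter. *)
Definition weak_dist (f g : Auto) : R :=
  inf [set a : R |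
    (mu [set x | (a < mdist (repr f x : X) (repr g x))%R] < a%:E)%E].

Definition weak_open (U : set Auto) : Prop :=
  forall f, U f -> exists2 e, 0 < e & forall g, weak_dist f g < e -> U g.

Lemma weak_openT : weak_open setT.
Proof. by move=> f _; exists 1. Qed.

Lemma weak_openI : setI_closed weak_open.
Proof.
move=> U V oU oV f [/oU[e e0 eU] /oV[e' e'0 eV]].
exists (Num.min e e'); first by rewrite lt_min e0.
by move=> g; rewrite lt_min => /andP[/eU ? /eV ?].
Qed.

Lemma weak_open_bigcup (I : Type) (F : I -> set Auto) :
  (forall i, weak_open (F i)) -> weak_open (\bigcup_i F i).
Proof.
move=> oF f [i _ /oF[e e0 eF]]; exists e => // g /eF Fg.
by exists i.
Qed.

HB.instance Definition _ :=
  isOpenTopological.Build Auto weak_openT weak_openI weak_open_bigcup.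

Definition periodic_points (f : borel X -> borel X) : set (borel X) :=
  [set x | exists2 k, (0 < k)%N & iter k f x = x].

Definition aperiodic (f : Auto) : Prop :=
  mu.-negligible (periodic_points (repr f)).

End automorphisms.

(* Main.v *)
(** For the G_delta part, let W(k, m) be the set of f such that the points fixed
    by f^k have measure less than 1/m; the aperiodic automorphisms form the
    intersection of these sets, so it suffices that each one is open. The key is
    that f |-> f^-1(A) is continuous for every Borel set A: the sets A for
    which mu (f^-1(A) \ g^-1(A)) is small when g is weakly close to f form a
    sigma-algebra containing the open sets. By induction the same holds for
    f^-k(A), and the complement of the set of fixed points of f^k is the union
    of the sets B \ f^-k(B), B in a countable family separating points.

    For density, X is Borel isomorphic to a subset of the real line, with a
    measurable left inverse defined on the whole line. The periodic points of
    f which are minimal in their orbit for the order of the line form a Borel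
    set E meeting every periodic orbit exactly once. If tau is supported on E,
    the first return map of tau o f to E is tau on E, so tau o f is
    aperiodic as soon as tau is aperiodic on E. Such a tau, moving no point by
    more than e, is obtained by cutting E into pieces of diameter at most e: the
    distribution function of an atomless law turns each piece, up to null sets,
    into the unit interval with the uniform law, where an irrational rotation
    is aperiodic. *)

Require Import Defs.
From mathcomp Require Import all_boot all_order all_algebra.
From mathcomp Require Import all_classical all_reals all_analysis.
From mathcomp Require Import finmap measurable_realfun borel_hierarchy.
From mathcomp Require Import ring lra.

Set Implicit Arguments.
Unset Strict Implicit.
Unset Printing Implicit Defensive.

Import Order.TTheory GRing.Theory Num.Theory.
Import numFieldNormedType.Exports.
Local Open Scope classical_set_scope.
Local Open Scope ring_scope.

(** * Coding sequences of bits by real numbers *)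

Section binary_coding.
Context {R : realType}.
Implicit Types b : nat -> bool.

(** In base 3 with digits 0 and 1 a bit weighs more than all later bits together, so every digit can
    be read off the sum; in base 2 dyadic numbers would have two expansions. *)
Definition code_seq b : R ^nat := [sequence (b k)%:R * 3^-1 ^+ k]_k.

Definition code b : R := limn (series (code_seq b)).

Lemma code_seq_ge0 b k : 0 <= code_seq b k.
Proof. by rewrite mulr_ge0// exprn_ge0. Qed.

Lemma code_seq_le b k : code_seq b k <= geometric 1 3^-1 k.
Proof. by rewrite /= ler_wpM2r ?exprn_ge0// lern1 leq_b1. Qed.

Lemma norm_third_lt1 : `|3^-1 : R| < 1.
Proof. by rewrite ger0_norm// invf_lt1// ltr1n. Qed.

Lemma is_cvg_code b : cvgn (series (code_seq b)).
Proof.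
apply: (@series_le_cvg _ _ (geometric 1 3^-1)) => [k|k|k|].
- exact: code_seq_ge0.
- by rewrite geometric_ge0.
- exact: code_seq_le.
- exact/is_cvg_geometric_series/norm_third_lt1.
Qed.

Lemma code_ge0 b : 0 <= code b.
Proof.
apply: limr_ge; first exact: is_cvg_code.
by apply: nearW => k; rewrite sumr_ge0// => i _; exact: code_seq_ge0.
Qed.

Lemma code_le b : code b <= 3 / 2.
Proof.
have -> : 3 / 2 = limn (series (geometric 1 (3^-1 : R))).
  rewrite (cvg_lim (@Rhausdorff R) (@cvg_geometric_series R 1 _ norm_third_lt1)).
  by field.
apply: lim_series_le; first exact: is_cvg_code.
- exact/is_cvg_geometric_series/norm_third_lt1.
- exact: code_seq_le.
Qed.

Lemma codeS b : code b = (b 0%N)%:R + code (b \o succn) / 3.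
Proof.
apply: cvg_lim => //; rewrite -cvg_shiftS /=.
rewrite [X in X @ _ --> _](_ : _ = fun k => (b 0%N)%:R +
    series (code_seq (b \o succn)) k / 3); last first.
  apply/funext => k; rewrite /series/= big_nat_recl// /code_seq/= expr0 mulr1.
  congr (_ + _); rewrite mulr_suml; apply: eq_bigr => i _.
  by rewrite exprSr mulrA.
apply: cvgD; first exact: cvg_cst.
by apply: cvgMr_tmp; exact: is_cvg_code.
Qed.

(* The tail of a code is at most 3/2, so that its leading digit is 1 if and
   only if the code is at least 1. *)
Definition code_shift (s : R) : R := 3 * (s - (1 <= s)%R%:R).

Definition code_digit (k : nat) (s : R) : bool := 1 <= iter k code_shift s.

Lemma code_head b : (1 <= code b) = b 0%N.
Proof.
rewrite codeS; have := code_le (b \o succn); have := code_ge0 (b \o succn).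
by case: (b 0%N) => /=; rewrite ?mulr1n ?mulr0n => ? ?; apply/idP; lra.
Qed.

Lemma code_shiftE b : code_shift (code b) = code (b \o succn).
Proof. by rewrite /code_shift code_head codeS; field. Qed.

Lemma iter_code_shift b k : iter k code_shift (code b) = code (fun i => b (k + i)%N).
Proof.
elim: k => //= k ->; rewrite code_shiftE; congr code.
by apply/funext => i /=; rewrite addSnnS.
Qed.

Lemma code_digitE b k : code_digit k (code b) = b k.
Proof. by rewrite /code_digit iter_code_shift code_head addn0. Qed.

Lemma measurable_code_shift : measurable_fun setT code_shift.
Proof.
apply: measurable_funM => //; apply: measurable_funB => //.
rewrite [X in measurable_fun _ X](_ : _ = \1_(`[1, +oo[ : set R)); last first.
  by apply/funext => s; rewrite indicE mem_setE in_itv/= andbT.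
exact: measurable_indic.
Qed.

Lemma measurable_code_digit k : measurable [set s | code_digit k s].
Proof.
have mk : measurable_fun setT (iter k code_shift).
  elim: k => [|k ih]; first exact: measurable_id.
  exact: (measurableT_comp measurable_code_shift ih).
have := mk measurableT `[1, +oo[%classic (measurable_itv _).
rewrite setTI; congr measurable; apply/seteqP; split => s /=;
  by rewrite in_itv/= andbT.
Qed.

End binary_coding.

Lemma measurable_code {R : realType} d (T : measurableType d)
    (B : (set T)^nat) : (forall k, measurable (B k)) ->
  measurable_fun setT (fun x => code (fun k => x \in B k) : R).
Proof.
move=> mB; apply: (@measurable_fun_cvg _ _ _ _
  (fun m x => series (code_seq (fun k => x \in B k)) m)) => [m|x _].
  rewrite /series/=; apply: measurable_sum => k; apply: measurable_funM => //.
  exact: measurable_indic.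
exact: is_cvg_code.
Qed.

(** * A compact metric space as a measurable retract of the real line *)

Section measurable_predicates.
Context d (T : measurableType d).

Lemma measurable_exists (P : nat -> T -> Prop) :
  (forall k, measurable [set x | P k x]) -> measurable [set x | exists k, P k x].
Proof.
move=> mP; rewrite [X in measurable X](_ : _ = \bigcup_k [set x | P k x]).
  exact: bigcupT_measurable.
by apply/seteqP; split => x /= [k]; exists k.
Qed.

Lemma measurable_forall (P : nat -> T -> Prop) :
  (forall k, measurable [set x | P k x]) -> measurable [set x | forall k, P k x].
Proof.
move=> mP; rewrite [X in measurable X](_ : _ = \bigcap_k [set x | P k x]).
  exact: bigcapT_measurable.
by apply/seteqP; split => x /= Px k; [move=> _|]; exact: Px.
Qed.

Lemma measurable_impl (P Q : T -> Prop) : measurable [set x | P x] ->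
  measurable [set x | Q x] -> measurable [set x | P x -> Q x].
Proof.
move=> mP mQ; rewrite [X in measurable X](_ : _ = ~` [set x | P x] `|` [set x | Q x]).
  by apply: measurableU => //; exact: measurableC.
apply/seteqP; split => x /= => [PQ|[//|//]].
by have [/PQ|] := pselect (P x); [right|left].
Qed.

Lemma measurable_Prop (P : Prop) : measurable [set x : T | P].
Proof.
have [HP|HP] := pselect P; first by
  rewrite [X in measurable X](_ : _ = setT)//; apply/seteqP; split.
rewrite [X in measurable X](_ : _ = set0)//.
by apply/seteqP; split.
Qed.

End measurable_predicates.

(** The default 0 keeps the search total: a real that codes no point may have no admissible
    index. *)
Definition first_index (P : nat -> bool) : nat :=
  if pselect (exists j, P j) is left exP then ex_minn exP else 0%N.

Lemma first_indexP (P : nat -> bool) : (exists j, P j) -> P (first_index P).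
Proof.
by rewrite /first_index; case: pselect => // exP _; case: ex_minnP.
Qed.

Lemma first_index_eq (P : nat -> bool) j : first_index P = j <->
  (P j /\ forall i, (i < j)%N -> ~ P i) \/ ((forall i, ~ P i) /\ j = 0%N).
Proof.
rewrite /first_index; case: pselect => [exP|nexP].
  case: ex_minnP => m Pm minm; split => [<-|[[Pj minj]|[nP _]]].
  - by left; split => // i; apply: contraTnot => /minm; rewrite -leqNgt.
  - apply/eqP; rewrite eqn_leq minm//= leqNgt; apply/negP => /minj; exact.
  - by case: exP => i /nP.
split => [<-|[[Pj _]|[_ ->]]//]; last by case: nexP; exists j.
by right; split => // i Pi; apply: nexP; exists i.
Qed.

(** Splitting over the countably many values of the index reduces the claim to fixed indices. The
    predicate may itself depend on the point, which allows nested selections. *)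
Lemma measurable_first_index d (T : measurableType d) (P : nat -> T -> bool)
    (C : nat -> T -> Prop) :
  (forall j, measurable [set x | P j x]) ->
  (forall j, measurable [set x | C j x]) ->
  measurable [set x | C (first_index (P ^~ x)) x].
Proof.
move=> mP mC; rewrite [X in measurable X](_ : _ =
    [set x | exists j, C j x /\ first_index (P ^~ x) = j]); last first.
  apply/seteqP; split => x /=; last by move=> [j [Cj fj]]; rewrite fj.
  by move=> Cx; eexists; split; [exact: Cx|].
apply: measurable_exists => j; apply: measurableI; first exact: mC.
rewrite [X in measurable X](_ : _ = [set x |
  (P j x /\ forall i, (i < j)%N -> ~ P i x) \/ ((forall i, ~ P i x) /\ j = 0%N)]).
  have mNP i : measurable [set x | ~ P i x] by exact: measurableC (mP i).
  apply: measurableU; apply: measurableI.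
  - exact: mP.
  - apply: measurable_forall => i; apply: measurable_impl => //.
    exact: measurable_Prop.
  - exact: measurable_forall.
  - exact: measurable_Prop.
by apply/seteqP; split => x;
  [exact: (first_index_eq (P ^~ x) j).1|exact: (first_index_eq (P ^~ x) j).2].
Qed.

Section standard_coding.
Context {R : realType} {X : pmetricType R}.

Definition rad (k : nat) : R := k.+1%:R^-1.

Lemma rad_gt0 k : 0 < rad k. Proof. by rewrite invr_gt0. Qed.

Lemma rad_lt (e : R) : 0 < e -> exists k, rad k < e.
Proof. by move=> /ltr_add_invr[k]; rewrite add0r; exists k. Qed.

Lemma rad_le i j : (i <= j)%N -> rad j <= rad i.
Proof. by move=> ij; rewrite lef_pV2 ?posrE// ler_nat. Qed.

Lemma open_ball_mdist (x : X) (e : R) : open [set y | mdist x y < e].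
Proof.
rewrite openE => y /= xy.
rewrite /interior -nbhs_ballE; exists (e - mdist x y); rewrite /= ?subr_gt0//.
move=> z; rewrite ballEmdist/= => yz.
by rewrite (le_lt_trans (metric_triangle x y z))// -ltrBrDl.
Qed.

Lemma compact_finite_net (e : R) : compact [set: X] -> 0 < e ->
  exists s : seq X, forall x, exists2 y, y \in s & mdist y x < e.
Proof.
move=> + e0; rewrite compact_cover.
move=> /(_ X setT (fun x => [set y | mdist x y < e])).
case=> [x _|x _|D _ DP]; first exact: open_ball_mdist.
  by exists x => //=; rewrite mdistxx.
by exists D => x; have [y yD xy] := DP x I; exists y.
Qed.

Lemma compact_net : compact [set: X] ->
  exists q : nat -> nat -> X, forall k x, exists j, mdist (q k j) x < rad k.
Proof.
move=> cX; suff net k : exists q : nat -> X, forall x, exists j, mdist (q j) x < rad k.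
  by have [q qP] := choice net; exists q.
have [s sP] := compact_finite_net cX (rad_gt0 k).
by exists (nth point s) => x; have [y ys yx] := sP x; exists (index y s); rewrite nth_index.
Qed.

Lemma mdist_eq0 (x y : X) : (forall k, mdist x y <= 4 * rad k) -> x = y.
Proof.
move=> xy; apply/mdist_positivity/eqP; rewrite eq_le mdist_ge0 andbT leNgt.
apply/negP => d0; have [k kd] : exists k, rad k < mdist x y / 4 by apply: rad_lt; rewrite divr_gt0.
by have := xy k; lra.
Qed.

Lemma open_mdist (U : set X) x : open U -> U x ->
  exists2 e, 0 < e & forall y, mdist x y < e -> U y.
Proof.
rewrite openE => /[apply]; rewrite /interior -nbhs_ballE => -[e/= e0 eU].
by exists e => // y xy; apply: eU; rewrite ballEmdist.
Qed.

(** A cluster point serves as limit: some later term lies within [rad k] of it, which adds to the 2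
    [rad k] of the hypothesis. *)
Lemma compact_cauchy_limit (u : nat -> X) : compact [set: X] ->
  (forall i j, (i <= j)%N -> mdist (u i) (u j) <= 2 * rad i) ->
  exists p, forall k, mdist (u k) p <= 3 * rad k.
Proof.
move=> cX uP; have [p [_ clp]] := cX (u @ \oo) _ filterT.
exists p => k.
have Fk : (u @ \oo) [set y | exists2 j, (k <= j)%N & y = u j].
  by exists k => // j /= kj; exists j.
have Bk : nbhs p [set y | mdist p y < rad k].
  by rewrite -ballEmdist; apply: nbhsx_ballx; exact: rad_gt0.
have [_ [[j kj ->]]] := clp _ _ Fk Bk.
rewrite /= metric_sym => jp; have := uP _ _ kj.
by have := metric_triangle (u k) (u j) p; lra.
Qed.

(** The code of a point records which net balls contain it. Decoding takes, at each scale, the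
    centre of the first ball recorded, and passes to the limit of these centres. *)
Lemma standard_coding : compact [set: X] ->
  exists (phi : borel X -> R) (psi : R -> borel X),
    [/\ measurable_fun setT phi, measurable_fun setT psi & cancel phi psi].
Proof.
move=> cX; have [q qP] := compact_net cX.
pose B (k : nat) : set (borel X) := if (choice.unpickle k : option (nat * nat)) is Some (i, j)
  then [set y : X | mdist (q i j) y < rad i] else set0.
have mB k : measurable (B k).
  rewrite /B; case: choice.unpickle => [[i j]|]; last exact: measurable0.
  by apply: sub_sigma_algebra; exact: open_ball_mdist.
pose phi (x : borel X) : R := code (fun k => x \in B k).
pose D (i j : nat) (s : R) := code_digit (choice.pickle (i, j)) s.
have Dphi (i j : nat) (x : borel X) : D i j (phi x) = (mdist (q i j) (x : X) < rad i).
  rewrite /D code_digitE /B choice.pickleK; apply/idP/idP; first by move/set_mem.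
  by move=> ?; exact: mem_set.
pose u i s := q i (first_index (D i ^~ s)).
have uphi i x : mdist (u i (phi x)) x < rad i.
  rewrite -Dphi; apply: (@first_indexP (D i ^~ (phi x))).
  by have [j] := qP i x; rewrite -Dphi; exists j.
(* Outside the range of [phi] the centres need not be coherent; [psi] then takes the default value
   [point], at the cost of a measurable case split. *)
pose C s := forall i j, (i <= j)%N -> mdist (u i s) (u j s) <= 2 * rad i.
have [psi psiP] : exists psi : R -> X, forall s,
    (C s -> forall k, mdist (u k s) (psi s) <= 3 * rad k) /\
    (~ C s -> psi s = point).
  suff psi_ s : exists p, (C s -> forall k, mdist (u k s) p <= 3 * rad k) /\
    (~ C s -> p = point) by have [psi psiP] := choice psi_; exists psi.
  have [Cs|nCs] := pselect (C s); last by exists point; split.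
  by have [p pP] := compact_cauchy_limit cX Cs; exists p; split.
have Cphi x : C (phi x).
  move=> i j ij; have := rad_le ij; have := uphi i x; have := uphi j x.
  rewrite (metric_sym (u j _)).
  by have := metric_triangle (u i (phi x)) x (u j (phi x)); lra.
exists phi, psi; split.
- exact: measurable_code.
- have mD i j : measurable [set s | D i j s] by exact: measurable_code_digit.
  have mu i (Q : X -> Prop) : measurable [set s | Q (u i s)].
    apply: (@measurable_first_index _ _ (D i) (fun j _ => Q (q i j))) => // j.
    exact: measurable_Prop.
  have mC : measurable [set s | C s].
    apply: measurable_forall => i; apply: measurable_forall => j.
    apply: measurable_impl; first exact: measurable_Prop.
    apply: (@measurable_first_index _ _ (D i)
      (fun k s => mdist (q i k) (u j s) <= 2 * rad i)) => // k.
    exact: (mu j (fun z => mdist (q i k) z <= 2 * rad i)).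
  apply: (@measurability _ _ _ (borel X) setT psi (@open X)) => //.
  (* The limit is eliminated: on [C], [psi s] lies in U exactly when, for some k, the ball of radius
     4 [rad k] around [u k s] is inside U, a condition on one centre only. *)
  move=> _ [U oU <-]; rewrite setTI [X in measurable X](_ : _ =
    ([set s | C s] `&` [set s | exists k, forall y, mdist (u k s) y < 4 * rad k -> U y])
    `|` ([set s | ~ C s] `&` [set s | U point])).
    apply: measurableU; apply: measurableI => //.
    - apply: measurable_exists => k.
      exact: (mu k (fun z => forall y, mdist z y < 4 * rad k -> U y)).
    - exact: measurableC.
    - exact: measurable_Prop.
  apply/seteqP; split => s /=.
    have [Cs|nCs] := pselect (C s); last by rewrite (psiP s).2//; right.
    move=> Us; left; split => //; have [e e0 eU] := open_mdist oU Us.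
    (* Here 7 = 3 + 4: [psi s] is within 3 [rad k] of the centre, and y within 4 [rad k]. *)
    have [k ke] : exists k, rad k < e / 7 by apply: rad_lt; rewrite divr_gt0.
    exists k => y uy; apply: eU; have := (psiP s).1 Cs k; rewrite metric_sym.
    by have := metric_triangle (psi s) (u k s) y; lra.
  case=> [[Cs [k kU]]|[nCs]]; last by rewrite (psiP s).2.
  apply: kU; have := (psiP s).1 Cs k; have := rad_gt0 k; lra.
- move=> x; apply: (@mdist_eq0 (psi (phi x)) x) => k.
  have := (psiP (phi x)).1 (Cphi x) k; have := uphi k x.
  rewrite (metric_sym (u k _) (psi _)).
  by have := metric_triangle (psi (phi x)) (u k (phi x)) x; lra.
Qed.

End standard_coding.

(** * Quantiles of an atomless law *)

Section quantile.
Context {R : realType} d (T : measurableType d) (P : probability T R).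
Variable X : {RV P >-> R}.
Implicit Types e s t : R.

Definition rcdf (s : R) : R := fine (cdf X s).

Lemma rcdfE s : (rcdf s)%:E = P (X @^-1` `]-oo, s]).
Proof. by rewrite fineK// fin_num_measure//; exact: measurable_funPTI. Qed.

Lemma rcdf_nondecreasing : nondecreasing_fun rcdf.
Proof.
by move=> s t st; rewrite fine_le ?fin_num_measure//; exact: cdf_nondecreasing.
Qed.

Lemma rcdf_right s e : 0 < e -> exists2 t, s < t & rcdf t < rcdf s + e.
Proof.
move=> e0; have : rcdf r @[r --> s^'+] --> rcdf s.
  by apply: fine_cvg; rewrite fineK ?fin_num_measure//; exact: cdf_right_continuous.
move/cvgr_lt => /(_ (rcdf s + e)); rewrite ltrDl => /(_ e0) st.
have [t [? ?]] := filter_ex (filterI (nbhs_right_gt s) st).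
by exists t.
Qed.

Lemma rcdf_gt t : t < 1 -> exists s, t < rcdf s.
Proof.
move=> t1; have /fine_cvg/cvgr_gt/(_ t t1) := cvg_cdfy1 X.
by move=> /filter_ex [s ?]; exists s.
Qed.

Lemma rcdf_lt t : 0 < t -> exists s, rcdf s < t.
Proof.
move=> t0; have /fine_cvg/cvgr_lt/(_ t t0) := cvg_cdfNy0 X.
by move=> /filter_ex [s ?]; exists s.
Qed.

(** Generalised inverse of the distribution function. Outside ]0, 1[ the set may be empty or
    unbounded below, hence the default. *)
Definition quantile (t : R) : R :=
  if 0 < t < 1 then inf [set s | t <= rcdf s] else 0.

Lemma has_inf_quantile t : 0 < t < 1 -> has_inf [set s | t <= rcdf s].
Proof.
move=> /andP[t0 t1]; split; first by have [s /ltW] := rcdf_gt t1; exists s.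
have [s st] := rcdf_lt t0; exists s => r /= tr; rewrite leNgt; apply/negP => rs.
by have := rcdf_nondecreasing (ltW rs); rewrite leNgt (lt_le_trans st).
Qed.

(** By right continuity the infimum is attained, which makes the quantile and the distribution
    function adjoint. *)
Lemma quantile_le t s : 0 < t < 1 -> (quantile t <= s) = (t <= rcdf s).
Proof.
move=> t01; have qinf := has_inf_quantile t01.
rewrite /quantile t01; apply/idP/idP => [qs|ts]; last exact: (ge_inf qinf.2).
rewrite leNgt; apply/negP => st.
have [r sr] : exists2 r, s < r & rcdf r < rcdf s + (t - rcdf s).
  by apply: rcdf_right; rewrite subr_gt0.
rewrite addrC subrK => rt.
have [u /= tu ur] := inf_adherent (eps := r - inf [set s | t <= rcdf s])
  (ltac:(by rewrite subr_gt0 (le_lt_trans qs))) qinf.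
rewrite addrC subrK in ur; have /rcdf_nondecreasing := ltW ur.
by rewrite leNgt (lt_le_trans rt).
Qed.

Lemma measurable_quantile : measurable_fun setT quantile.
Proof.
apply: (measurability _ (RGenOInfty.measurableE R)) => //.
move=> _ [_ [s ->] <-]; rewrite setTI.
rewrite [X in measurable X](_ : _ = (`]0, 1[ `&` ~` `]-oo, rcdf s]) `|`
    (~` `]0, 1[ `&` [set t : R | s < 0])).
  apply: measurableU; apply: measurableI => //; try exact: measurableC.
  exact: measurable_Prop.
apply/seteqP; split => t /=; rewrite !in_itv/= andbT.
  have [t01|t01] := boolP (0 < t < 1).
    by rewrite ltNge quantile_le// => /negP; left.
  by rewrite /quantile (negPf t01) => s0; right.
case=> [[t01 /negP]|[/negP t01]]; first by rewrite ltNge quantile_le.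
by rewrite /quantile (negPf t01).
Qed.

Hypothesis X0 : forall s, P (X @^-1` [set s]) = 0%E.

(** Without atoms the open and closed half-lines ending at s have the same measure, and the open one
    is an increasing union of closed ones. *)
Lemma rcdf_left s e : 0 < e -> exists2 t, t < s & rcdf s - e < rcdf t.
Proof.
move=> e0; apply: contrapT => nt.
pose F k := X @^-1` `]-oo, s - rad k].
have mF k : measurable (F k) by exact: measurable_funPTI.
have UF : \bigcup_k F k = X @^-1` `]-oo, s[.
  rewrite -preimage_bigcup; congr (X @^-1` _); apply/seteqP; split => r /=.
    move=> [k _] /=; rewrite !in_itv/= => /le_lt_trans; apply.
    by rewrite gtrBl rad_gt0.
  rewrite in_itv/= => rs; have [k ks] : exists k, rad k < s - r.
    by apply: rad_lt; rewrite subr_gt0.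
  by exists k => //=; rewrite in_itv/=; lra.
have Pls : P (X @^-1` `]-oo, s[) = (rcdf s)%:E.
  rewrite rcdfE -(@setUitv1 _ _ -oo%O s true)// preimage_setU measureU//.
  - by rewrite [X in (_ + X)%E]X0 adde0.
  - exact: measurable_funPTI.
  - by apply/seteqP; split => // x /= []; rewrite in_itv/= => + xs; rewrite xs ltxx.
have : P \o F @ \oo --> (rcdf s)%:E.
  rewrite -Pls -UF; apply: nondecreasing_cvg_mu => //.
    exact: bigcup_measurable.
  move=> i j ij; apply/subsetPset => x; rewrite /F /= !in_itv/= => /le_trans; apply.
  by rewrite lerD2l lerN2 rad_le.
move=> /[dup] /cvg_lim Fs /cvgP cF.
have : (limn (P \o F) <= (rcdf s - e)%:E)%E.
  apply: lime_le => //; apply: nearW => k.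
  rewrite /= -rcdfE lee_fin leNgt; apply/negP => ?; apply: nt.
  by exists (s - rad k) => //; rewrite gtrBl rad_gt0.
by rewrite Fs// lee_fin lerDl oppr_ge0 leNgt e0.
Qed.

Lemma rcdf_quantile t : 0 < t < 1 -> rcdf (quantile t) = t.
Proof.
move=> t01; apply/eqP; rewrite eq_le -quantile_le// lexx andbT leNgt.
apply/negP; rewrite -subr_gt0 => /(rcdf_left (quantile t))[s sq].
rewrite subKr => /ltW; rewrite -quantile_le//.
by rewrite leNgt sq.
Qed.

Lemma rcdf_ge0 s : 0 <= rcdf s. Proof. by rewrite fine_ge0. Qed.

Lemma rcdf_le1 s : rcdf s <= 1.
Proof. by rewrite -lee_fin rcdfE probability_le1//; exact: measurable_funPTI. Qed.

Lemma measurable_rcdf : measurable_fun setT (rcdf \o X).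
Proof.
apply: measurableT_comp => //; apply: nondecreasing_measurable => //.
exact: rcdf_nondecreasing.
Qed.

Let mU t : measurable [set x | rcdf (X x) <= t].
Proof.
have := measurable_rcdf measurableT (measurable_itv `]-oo, t]); rewrite setTI.
by congr measurable; apply/seteqP; split => x /=; rewrite in_itv.
Qed.

(** The value t may be taken on a whole interval beyond its quantile, so the bound goes through the
    quantile of some u slightly above t. *)
Lemma rcdf_uniform_le t : 0 <= t < 1 -> (P [set x | rcdf (X x) <= t]%R <= t%:E)%E.
Proof.
move=> /andP[t0 t1]; apply/lee_addgt0Pr => e e0.
(* To have a quantile, u must stay below 1, hence the midpoint of t and 1 when e is large. *)
have [u [u0 u1 tu ue]] : exists u, [/\ 0 < u, u < 1, t < u & u <= t + e].
  have [h|h] := leP (t + e) ((t + 1) / 2); [exists (t + e)|exists ((t + 1) / 2)];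
    by split; lra.
have u01 : 0 < u < 1 by rewrite u0.
apply: (@le_trans _ _ u%:E); last by rewrite -EFinD lee_fin.
rewrite -{1}(rcdf_quantile u01) rcdfE; apply: le_measure;
  [exact/mem_set/mU|exact/mem_set/measurable_funPTI|].
move=> x /= xt; rewrite in_itv/= leNgt; apply/negP => /ltW /rcdf_nondecreasing.
by rewrite rcdf_quantile// leNgt (le_lt_trans xt).
Qed.

Lemma rcdf_uniform t : 0 <= t <= 1 -> P [set x | rcdf (X x) <= t]%R = t%:E.
Proof.
move=> /andP[t0]; rewrite le_eqVlt => /predU1P[->|t1].
  rewrite (_ : [set x | _] = setT) ?probability_setT//.
  by apply/seteqP; split => // x _ /=; exact: rcdf_le1.
apply/eqP; rewrite eq_le rcdf_uniform_le ?t0//=.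
have /predU1P[<-//|{}t0] : (0 == t) || (0 < t) by rewrite -le_eqVlt.
have t01 : 0 < t < 1 by rewrite t0.
rewrite -{1}(rcdf_quantile t01) rcdfE; apply: le_measure;
  [exact/mem_set/measurable_funPTI|exact/mem_set/mU|].
by move=> x /=; rewrite in_itv/= => /rcdf_nondecreasing; rewrite rcdf_quantile.
Qed.

End quantile.

(** * Irrational rotations of the uniform law *)

Section uniform_rotation.
Context {R : realType} d (T : measurableType d) (P : probability T R).
Local Open Scope ereal_scope.
Implicit Types a s t y : R.

Definition uniform01 (U : T -> R) : Prop :=
  forall t, (0 <= t <= 1)%R -> P [set x | U x <= t]%R = t%:E.

(** The distribution function of the uniform law, on the whole line. *)
Definition clip01 (t : R) : R := Num.max 0%R (Num.min t 1%R).

Lemma clip01_le0 t : (t <= 0)%R -> clip01 t = 0%R.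
Proof. by move=> t0; rewrite /clip01 max_l// ge_min t0. Qed.

Lemma clip01_id t : (0 <= t)%R -> (t <= 1)%R -> clip01 t = t.
Proof. by move=> t0 t1; rewrite /clip01 min_l// max_r. Qed.

Lemma clip01_ge1 t : (1 <= t)%R -> clip01 t = 1%R.
Proof. by move=> t1; rewrite /clip01 min_r// max_r. Qed.

Lemma measurable_le_cst (U : T -> R) t : measurable_fun setT U ->
  measurable [set x | U x <= t]%R.
Proof.
move=> mU; have := mU measurableT _ (measurable_itv `]-oo, t]); rewrite setTI.
by congr measurable; apply/seteqP; split => x /=; rewrite in_itv.
Qed.

Lemma uniform01_le (U : T -> R) t : measurable_fun setT U -> uniform01 U ->
  P [set x | U x <= t]%R = (clip01 t)%:E.
Proof.
move=> mU uU; rewrite /clip01; have [t1|t1] := leP t 1%R.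
  have [t0|t0] := leP 0%R t; first by rewrite uU ?t0.
  apply/eqP; rewrite eq_le measure_ge0 andbT.
  rewrite -[leRHS](uU 0%R) ?lexx ?ler01//; apply: le_measure.
  - exact/mem_set/measurable_le_cst.
  - exact/mem_set/measurable_le_cst.
  - by move=> x /= /le_trans; apply; exact: ltW.
rewrite max_r//; apply/eqP; rewrite eq_le probability_le1/=; last exact: measurable_le_cst.
rewrite -[leLHS](uU 1%R) ?lexx ?ler01//; apply: le_measure.
- exact/mem_set/measurable_le_cst.
- exact/mem_set/measurable_le_cst.
- by move=> x /= /le_trans; apply; exact: ltW.
Qed.

Lemma uniform01_setD (U : T -> R) s t : measurable_fun setT U -> uniform01 U ->
  P ([set x | U x <= t]%R `\` [set x | U x <= s]%R) =
  (clip01 t - clip01 (Num.min s t))%:E.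
Proof.
move=> mU uU; rewrite measureD; [|exact: measurable_le_cst|exact: measurable_le_cst|].
  rewrite (_ : _ `&` _ = [set x | U x <= Num.min s t]%R).
    by rewrite EFinB; congr (_ - _); exact: uniform01_le.
  by apply/seteqP; split => x /=; rewrite le_min; [move=> [-> ->]|case/andP].
by rewrite -ge0_fin_numE// fin_num_measure//; exact: measurable_le_cst.
Qed.

Lemma uniform01_eq (U : T -> R) t : measurable_fun setT U -> uniform01 U ->
  P [set x | U x = t] = 0.
Proof.
move=> mU uU; have mt : measurable [set x | U x = t].
  have := mU measurableT _ (measurable_set1 t); rewrite setTI.
  by congr measurable.
apply/eqP; rewrite eq_le measure_ge0 andbT; apply/lee_addgt0Pr => e e0.
rewrite add0e; apply: (@le_trans _ _
    (P ([set x | U x <= t]%R `\` [set x | U x <= t - e]%R))).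
  apply: le_measure; [exact: mem_set| |].
    by apply/mem_set/measurableD; exact: measurable_le_cst.
  by move=> x /= ->; split => //; apply/negP; rewrite -ltNge ltrBlDr ltrDl.
rewrite uniform01_setD// lee_fin /clip01 /Order.min /Order.max.
by repeat case: ifP; lra.
Qed.

Definition rotation (a y : R) : R := (if y <= 1 - a then y + a else y + a - 1)%R.

Lemma measurable_rotation a : measurable_fun setT (rotation a).
Proof.
apply: measurable_fun_ifT => //.
- by apply: measurable_fun_ler.
- exact: measurable_funD.
- by apply: measurable_funB => //; exact: measurable_funD.
Qed.

Lemma rotationK a y : (0 < a < 1)%R -> (0 < y < 1)%R ->
  rotation (1 - a) (rotation a y) = y.
Proof.
move=> /andP[? ?] /andP[? ?]; rewrite /rotation.
by have [?|?] := leP y (1 - a)%R; case: leP => ?; lra.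
Qed.

Lemma iter_rotation a k y : exists m : int, iter k (rotation a) y = (y + k%:R * a - m%:~R)%R.
Proof.
elim: k => [|k [m IHk]]; first by exists 0%R; rewrite mul0r addr0 subr0.
rewrite iterS IHk /rotation; case: ifP => _; [exists m|exists (m + 1)%R];
  by rewrite ?intrD -natr1; lra.
Qed.

(** Each step adds a up to an integer, at every real y, so a return after k steps would make k a an
    integer. *)
Lemma rotation_aperiodic a k y : irrational a -> (0 < k)%N ->
  iter k (rotation a) y <> y.
Proof.
move=> a_irr k0; have [m ->] := iter_rotation a k y => /eqP.
rewrite -addrA -[eqbRHS]addr0 (inj_eq (addrI y)) subr_eq0 => /eqP kam.
apply: a_irr; apply/rationalP; exists m, k; rewrite -kam mulrC mulKf//.
by rewrite pnatr_eq0 -lt0n.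
Qed.

Lemma uniform01_rotation (U : T -> R) a : (0 < a < 1)%R ->
  measurable_fun setT U -> uniform01 U -> uniform01 (rotation a \o U).
Proof.
move=> /andP[? ?] mU uU t /andP[? ?].
(* First the points that do not wrap around, then those that do. For t at most a the first part is
   null; beyond a the second fills the whole arc above 1 - a. *)
rewrite (_ : [set x | _] = [set x | U x <= Num.min (1 - a) (t - a)]%R `|`
    ([set x | U x <= t + 1 - a]%R `\` [set x | U x <= 1 - a]%R)).
  rewrite measureU.
  - transitivity ((clip01 (Num.min (1 - a) (t - a)))%:E +
        (clip01 (t + 1 - a) - clip01 (Num.min (1 - a) (t + 1 - a)))%:E).
      by congr (_ + _); [exact: uniform01_le|exact: uniform01_setD].
    rewrite -EFinD (_ : Num.min _ (t - a) = t - a)%R; last by rewrite min_r//; lra.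
    rewrite min_l; last by lra.
    rewrite (@clip01_id (1 - a)%R); [|lra|lra]; congr EFin.
    have [ta|ta] := leP t a.
      by rewrite clip01_le0 ?clip01_id; lra.
    by rewrite clip01_id ?clip01_ge1; lra.
  - exact: measurable_le_cst.
  - by apply: measurableD; exact: measurable_le_cst.
  - by apply/seteqP; split => // x /= [+ [_ +]]; rewrite le_min => /andP[].
apply/seteqP; split => x /=; rewrite /rotation.
  case: ifPn; first by rewrite le_min => ->/= ?; left; lra.
  by move=> /negP ? ?; right; split => //; lra.
case=> [|[? /negP/negPf ->]]; last by lra.
by rewrite le_min => /andP[->]; lra.
Qed.

(** Open upper half-lines generate the Borel sets and are stable under intersection, so agreement of
    the two laws on them suffices. *)
Lemma uniform01_law (U V : T -> R) B : measurable_fun setT U ->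
  measurable_fun setT V -> uniform01 U -> uniform01 V -> measurable B ->
  P (U @^-1` B) = P (V @^-1` B).
Proof.
move=> mU mV uU uV mB.
pose U' : {RV P >-> R} := mfun_Sub (mem_set mU).
pose V' : {RV P >-> R} := mfun_Sub (mem_set mV).
have gtE (W : T -> R) t : measurable_fun setT W -> uniform01 W ->
    P (W @^-1` `]t, +oo[) = 1 - (clip01 t)%:E.
  move=> mW uW; rewrite -(uniform01_le t mW uW) -probability_setC.
    congr (P _); apply/seteqP; split => x /=; rewrite in_itv/= andbT ltNge;
      by move/negP.
  exact: measurable_le_cst.
rewrite -[LHS]/(distribution P U' B) -[RHS]/(distribution P V' B).
apply: (measure_unique (@RGenOInfty.G R) (fun k => `](- k%:R)%R, +oo[%classic)
  _ _ _ _ (distribution P U') (distribution P V')) => //.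
- exact: RGenOInfty.measurableE.
- move=> _ _ [s ->] [t ->]; exists (Num.max s t).
  by apply/seteqP; split => x /=; rewrite !in_itv/= !andbT gt_max => /andP.
- by move=> k; exists (- k%:R)%R.
- apply/seteqP; split => // x _; exists (Num.bound x) => //=.
  by rewrite in_itv/= andbT ltrNl unstable.ltrNbound.
- move=> _ [t ->]; transitivity (1 - (clip01 t)%:E); first exact: gtE.
  exact/esym/gtE.
- by move=> k; rewrite ltey_eq fin_num_measure.
Qed.

End uniform_rotation.

(** * Aperiodic maps of an atomless probability space *)

Section measure_preserving.
Context d (T : measurableType d) {R : realType} (P : {measure set T -> \bar R}).

Definition preserving (S : T -> T) : Prop :=
  forall A, measurable A -> P (S @^-1` A) = P A.

Lemma measurable_iter (S : T -> T) k : measurable_fun setT S ->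
  measurable_fun setT (iter k S).
Proof.
move=> mS; elim: k => [|k IHk]; first exact: measurable_id.
exact: (measurableT_comp mS IHk).
Qed.

Lemma measurable_preimage (S : T -> T) A : measurable_fun setT S ->
  measurable A -> measurable (S @^-1` A).
Proof. by move=> mS mA; rewrite -[_ @^-1` _]setTI; exact: mS. Qed.

Lemma preserving_iter (S : T -> T) k : measurable_fun setT S ->
  preserving S -> preserving (iter k S).
Proof.
move=> mS pS; elim: k => [//|k IHk] A mA.
by rewrite -[LHS]/(P (iter k S @^-1` (S @^-1` A))) IHk ?pS//;
  exact: measurable_preimage.
Qed.

Lemma preserving_ae (S : T -> T) (Q : T -> Prop) : measurable_fun setT S ->
  preserving S -> {ae P, forall x, Q x} -> {ae P, forall x, Q (S x)}.
Proof.
move=> mS pS [N [mN N0 QN]]; exists (S @^-1` N); split.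
- exact: measurable_preimage.
- by rewrite pS.
- by move=> x /= nQ; exact: QN.
Qed.

Lemma preserving_ae_iter (S : T -> T) (Q : T -> Prop) : measurable_fun setT S ->
  preserving S -> {ae P, forall x, Q x} ->
  {ae P, forall x, forall k, Q (iter k S x)}.
Proof.
move=> mS pS aeQ; apply: ae_foralln => k.
by apply: preserving_ae aeQ; [exact: measurable_iter|exact: preserving_iter].
Qed.

Lemma ae_eq_measure (A B : set T) : measurable A -> measurable B ->
  {ae P, forall x, A x <-> B x} -> P A = P B.
Proof.
move=> mA mB [N [mN N0 AB]].
have sub C D : measurable C -> measurable D -> C `<=` D `|` N -> (P C <= P D)%E.
  move=> mC mD CDN; apply: (@le_trans _ _ (P (D `|` N))).
    by apply: le_measure => //; apply/mem_set => //; exact: measurableU.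
  by rewrite (le_trans (measureU2 _ mD mN))// [X in (_ + X)%E]N0 adde0.
apply/eqP; rewrite eq_le; apply/andP; split; apply: sub => // x Cx.
  have [|nB] := pselect (B x); [by left|right].
  by apply: AB => /= -[/(_ Cx)].
have [|nA] := pselect (A x); [by left|right].
by apply: AB => /= -[_ /(_ Cx)].
Qed.

End measure_preserving.

(** * Irrational rotations transported to an atomless space *)

Section rotation_model.
Context {R : realType} d (T : measurableType d) (P : probability T R).
Variables (phi : T -> R) (psi : R -> T).
Implicit Type a : R.
Hypotheses (mphi : measurable_fun setT phi) (mpsi : measurable_fun setT psi).
Hypothesis phiK : cancel phi psi.
Hypothesis phi0 : forall s, P (phi @^-1` [set s]) = 0%E.

Let X : {RV P >-> R} := mfun_Sub (mem_set mphi).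
Let U : T -> R := rcdf X \o X.
Let G : R -> T := psi \o quantile X.

Let mU : measurable_fun setT U. Proof. exact: measurable_rcdf. Qed.

Let mG : measurable_fun setT G.
Proof. exact: (measurableT_comp mpsi (measurable_quantile X)). Qed.

Let uU : uniform01 P U. Proof. by move=> t t01; exact: rcdf_uniform. Qed.

Let U01 : {ae P, forall x, 0 < U x < 1}.
Proof.
exists ([set x | U x = 0] `|` [set x | U x = 1]).
have m0 t : measurable [set x | U x = t].
  have := mU measurableT (measurable_set1 t); rewrite setTI.
  by congr measurable.
split; first exact: measurableU.
- apply: null_set_setU => //; exact: (uniform01_eq _ mU uU).
- move=> x /= /negP; rewrite negb_and -!leNgt => /orP[U0|U1]; [left|right];
    by apply/eqP; rewrite eq_le ?U0 ?U1 ?andbT ?rcdf_ge0 ?rcdf_le1.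
Qed.

(* If the quantile of [U x] lies strictly below [X x], then [U x] is the value
   of the distribution function at a rational. *)
Let GU : {ae P, forall x, G (U x) = x}.
Proof.
pose V q := rcdf X (if choice.unpickle q is Some r then ratr (r : rat) else 0).
have VU : {ae P, forall x, forall q, U x <> V q}.
  apply: ae_foralln => q; exists [set x | U x = V q]; split.
  - have := mU measurableT (measurable_set1 (V q)); rewrite setTI.
    by congr measurable.
  - exact: uniform01_eq.
  - by move=> x /= /contrapT.
apply: filterS2 U01 VU => x x01 xV; rewrite /G /= -[RHS]phiK; congr psi.
apply/eqP; rewrite eq_le quantile_le// lexx/= leNgt; apply/negP.
move=> /rat_in_itvoo[r]; rewrite in_itv/= => /andP[qr rx].
apply: (xV (choice.pickle r)); rewrite /V choice.pickleK.
apply/eqP; rewrite eq_le -quantile_le// (ltW qr)/=.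
exact/rcdf_nondecreasing/ltW.
Qed.

(** [U] has the uniform law and [G] inverts it almost everywhere, so this is the rotation conjugated
    by [U], up to null sets. *)
Definition rotated (a : R) : T -> T := G \o rotation a \o U.

Lemma measurable_rotated a : measurable_fun setT (rotated a).
Proof.
by apply: measurableT_comp => //; apply: measurableT_comp => //;
  exact: measurable_rotation.
Qed.

Let U_rotation a B : 0 < a < 1 -> measurable B ->
  P ((rotation a \o U) @^-1` B) = P (U @^-1` B).
Proof.
move=> a01 mB; apply: uniform01_law => //; last exact: uniform01_rotation.
exact: (measurableT_comp (measurable_rotation a) mU).
Qed.

Lemma preserving_rotated a : 0 < a < 1 -> preserving P (rotated a).
Proof.
move=> a01 A mA.
have mGA : measurable (G @^-1` A) by rewrite -[_ @^-1` _]setTI; exact: mG.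
transitivity (P (U @^-1` (G @^-1` A))); first exact: U_rotation.
apply: ae_eq_measure => //; first by rewrite -[_ @^-1` _]setTI; exact: mU.
by apply: filterS GU => x /= ->.
Qed.

(** From [G (U x) = x] one gets [U (G t) = t] for almost every t under the law of [U]. The rotation
    preserves this law, so the identity also holds almost surely at t = [rotation a (U x)]. *)
Let U_rotated a : 0 < a < 1 -> {ae P, forall x, U (rotated a x) = rotation a (U x)}.
Proof.
move=> a01; pose B := [set t | U (G t) = t].
have mB : measurable B.
  have mUG : measurable_fun setT (U \o G) by exact: measurableT_comp.
  have := measurable_funB mUG (@measurable_id _ _ setT) measurableT (measurable_set1 0).
  rewrite setTI; congr measurable; apply/seteqP; split => t /=.
    by move/eqP; rewrite subr_eq0 => /eqP.
  by move=> ->; rewrite subrr.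
have mW C (W : T -> R) : measurable C -> measurable_fun setT W -> measurable (W @^-1` C).
  by move=> mC mW; rewrite -[_ @^-1` _]setTI; exact: mW.
exists ((rotation a \o U) @^-1` (~` B)); split.
- apply: mW; first exact: measurableC.
  exact: (measurableT_comp (measurable_rotation a) mU).
- rewrite U_rotation//; last exact: measurableC.
  apply/negligibleP; first by apply: mW => //; exact: measurableC.
  by apply: negligibleS GU => x nB GUx; apply: nB; exact: (congr1 U GUx).
- by [].
Qed.

Lemma rotatedK a : 0 < a < 1 -> {ae P, forall x, rotated (1 - a) (rotated a x) = x}.
Proof.
move=> a01; apply: filterS3 (U_rotated a01) U01 GU => x Ux U01x GUx.
by rewrite -[LHS]/(G (rotation (1 - a) (U (rotated a x)))) Ux rotationK.
Qed.

(** Outside a null set [U] intertwines the map with the rotation along the whole orbit, so a period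
    of x would be a period of [U x] under the rotation. *)
Lemma rotated_aperiodic a : 0 < a < 1 -> irrational a ->
  {ae P, forall x, forall k, (0 < k)%N -> iter k (rotated a) x <> x}.
Proof.
move=> a01 a_irr.
have := preserving_ae_iter (measurable_rotated a) (preserving_rotated a01) (U_rotated a01).
apply: filterS => x Ux k k0 Skx.
have URk j : U (iter j (rotated a) x) = iter j (rotation a) (U x).
  by elim: j => //= j <-; rewrite -Ux.
by have := rotation_aperiodic (y := U x) a_irr k0; rewrite -URk Skx.
Qed.

End rotation_model.

(** * Automorphisms from almost everywhere inverse maps *)

Section equalizers.
Context {R : realType} d (T : measurableType d).

Lemma measurable_eqr (f g : T -> R) : measurable_fun setT f ->
  measurable_fun setT g -> measurable [set x | f x = g x].
Proof.
move=> mf mg; have := measurable_funB mf mg measurableT (measurable_set1 0).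
rewrite setTI; congr measurable; apply/seteqP; split => x /=.
  by move/eqP; rewrite subr_eq0 => /eqP.
by move=> ->; rewrite subrr.
Qed.

(** An injective real coding turns the equalizer into the zero set of a difference of real
    functions. *)
Lemma measurable_equalizer d' (T' : measurableType d') (phi : T' -> R)
    (f g : T -> T') : measurable_fun setT phi -> injective phi ->
  measurable_fun setT f -> measurable_fun setT g ->
  measurable [set x | f x = g x].
Proof.
move=> mphi iphi mf mg.
have := measurable_eqr (measurableT_comp mphi mf) (measurableT_comp mphi mg).
by congr measurable; apply/seteqP; split => x /=; [exact: iphi|move=> ->].
Qed.

End equalizers.

Section automorphism_of_ae_inverses.
Context {R : realType} {X : pmetricType R} (mu : probability (borel X) R).
Variables (phi : borel X -> R) (A : set (borel X)).
Hypotheses (mphi : measurable_fun setT phi) (iphi : injective phi).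
Hypothesis mA : measurable A.

Let muA : {measure set (borel X) -> \bar R} := mrestr mu mA.

Variables S S' : borel X -> borel X.
Hypotheses (mS : measurable_fun setT S) (mS' : measurable_fun setT S').
Hypotheses (pS : preserving muA S) (pS' : preserving muA S').
Hypothesis SK : {ae muA, forall x, S' (S x) = x}.
Hypothesis S'K : {ae muA, forall x, S (S' x) = x}.

Let C0 := A `&` ([set x | S' (S x) = x] `&` [set x | S (S' x) = x]).

(** Constraining the whole orbits under both maps makes the set stable under [S] and [S'], which are
    then inverse bijections of it. *)
Let C := [set x | forall k, C0 (iter k S x) /\ C0 (iter k S' x)].

Let mC0 : measurable C0.
Proof.
apply: measurableI => //; apply: measurableI;
  by apply: (measurable_equalizer mphi iphi) => //; exact: measurableT_comp.
Qed.

Let mC : measurable C.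
Proof.
apply: measurable_forall => k; apply: measurableI;
  by apply: measurable_preimage => //; exact: measurable_iter.
Qed.

Let aeC : {ae muA, forall x, C x}.
Proof.
have aeC0 : {ae muA, forall x, C0 x}.
  have aeA : {ae muA, forall x, A x}.
    exists (~` A); split => //; first exact: measurableC.
    by rewrite /muA/= /mrestr/= setICl measure0.
  by apply: filterS3 aeA SK S'K => x; split.
have := preserving_ae_iter mS' pS' aeC0.
by apply: filterS2 (preserving_ae_iter mS pS aeC0) => x ? ? k; split.
Qed.

Let CA : C `<=` A. Proof. by move=> x /(_ 0%N)[[]]. Qed.

Let SC x : C x -> C (S x).
Proof.
move=> Cx k; rewrite -iterSr; split; first exact: (Cx k.+1).1.
case: k => [|k]; first exact: (Cx 1%N).1.
by rewrite iterSr (Cx 0%N).1.2.1; exact: (Cx k).2.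
Qed.

Let S'C x : C x -> C (S' x).
Proof.
move=> Cx k; rewrite -(iterSr k S'); split; last exact: (Cx k.+1).2.
case: k => [|k]; first exact: (Cx 1%N).2.
by rewrite iterSr (Cx 0%N).1.2.2; exact: (Cx k).1.
Qed.

(** The identity off [C] turns almost everywhere inverse maps into true inverse bijections, as
    [automorphism] demands. *)
Let tau x := if x \in C then S x else x.
Let tau' x := if x \in C then S' x else x.

Let tauK : cancel tau tau'.
Proof.
move=> x; rewrite /tau; case: ifPn => [/set_mem Cx|nCx]; rewrite /tau'.
  by rewrite (mem_set (SC Cx)) (Cx 0%N).1.2.1.
by rewrite (negPf nCx).
Qed.

Let tau'K : cancel tau' tau.
Proof.
move=> x; rewrite /tau'; case: ifPn => [/set_mem Cx|nCx]; rewrite /tau.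
  by rewrite (mem_set (S'C Cx)) (Cx 0%N).1.2.2.
by rewrite (negPf nCx).
Qed.

Let measurable_patch (V : borel X -> borel X) : measurable_fun setT V ->
  measurable_fun setT (fun x => if x \in C then V x else x).
Proof.
move=> mV; apply: measurable_fun_ifT => //.
by apply: (measurable_fun_bool true); rewrite setTI preimage_mem_true.
Qed.

Lemma automorphism_of_ae_inverses : exists tau : automorphism mu,
  (forall x, ~ A x -> tau x = x) /\
  {ae muA, forall x, forall k, iter k tau x = iter k S x}.
Proof.
have mtau : measurable_fun setT tau by exact: measurable_patch.
have mtau' : measurable_fun setT tau' by exact: measurable_patch.
have tau_inv B : measurable B -> measurable (tau @` B).
  move=> mB; rewrite (_ : _ @` _ = tau' @^-1` B); first exact: measurable_preimage.
  apply/seteqP; split => x /=; first by move=> [y By <-]; rewrite tauK.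
  by exists (tau' x).
have tauA x : ~ A x -> tau x = x.
  by move=> nAx; rewrite /tau memNset// => /CA.
have ptau B : measurable B -> mu (tau @^-1` B) = mu B.
  move=> mB; have mtB := measurable_preimage mtau mB.
  (* Inside A the map is almost everywhere [S], which preserves the trace of [mu] on A; outside A
     nothing moves. *)
  have muE D : measurable D -> mu D = (muA D + mu (D `\` A))%E.
    move=> mD; rewrite [LHS](measureDI mu mD mA) addeC; congr (_ + _)%E.
  rewrite muE// [RHS]muE//; congr (_ + _)%E.
    rewrite -[RHS]pS//; apply: ae_eq_measure => //; first exact: measurable_preimage.
    by apply: filterS aeC => x Cx /=; rewrite /tau mem_set.
  congr (mu _); apply/seteqP; split => x /= [+ nAx]; by rewrite tauA.
exists (Automorphism (Bijective tauK tau'K) mtau tau_inv ptau); split => //=.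
apply: filterS aeC => x Cx k.
suff [] : C (iter k tau x) /\ iter k tau x = iter k S x by [].
elim: k => //= k [Ck <-]; rewrite {1 3}/tau mem_set//; split => //; exact: SC.
Qed.

End automorphism_of_ae_inverses.

(** * Perturbation of periodic orbits *)

Section periodic_orbits.
Context {R : realType} {X : pmetricType R}.
Implicit Types f tau : borel X -> borel X.

Lemma iter_period f p k x : iter p f x = x -> iter (k %% p) f x = iter k f x.
Proof.
move=> px; rewrite [in RHS](divn_eq k p) addnC iterD iterM.
by congr iter; rewrite iter_fix.
Qed.

Variable phi : borel X -> R.
Hypothesis iphi : injective phi.

(* The minimum of [phi] selects one point in each periodic orbit. *)
Definition orbit_minima f : set (borel X) :=
  [set x | periodic_points f x /\ forall i, phi x <= phi (iter i f x)].

Lemma orbit_minima_exists f x : periodic_points f x ->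
  exists i, orbit_minima f (iter i f x).
Proof.
move=> [p p0 px].
have [i _ imin] := @arg_minP _ _ 'I_p (Ordinal p0) xpredT
  (fun i => phi (iter i f x)) isT.
exists i; split; first by exists p => //; rewrite -iterD addnC iterD px.
move=> j; rewrite -iterD -(iter_period (j + i) px).
exact: (imin (Ordinal (ltn_pmod (j + i) p0)) isT).
Qed.

Lemma orbit_minima_unique f x k : orbit_minima f x ->
  orbit_minima f (iter k f x) -> iter k f x = x.
Proof.
move=> [[p p0 px] xmin] [_ kmin]; apply: iphi; apply/eqP.
rewrite eq_le xmin andbT.
(* From [iter k f x], another p k - k steps complete k periods and come back to x, so the minimality
   inequality holds in both directions. *)
have := kmin (p * k - k)%N; rewrite -iterD subnK ?leq_pmull//.
by rewrite mulnC iterM (iter_fix _ px).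
Qed.

Section perturbation.
Variables f tau : borel X -> borel X.
Let E := orbit_minima f.
Hypothesis tauE : forall x, E x -> E (tau x).
Hypothesis tau_id : forall x, ~ E x -> tau x = x.

Let g := tau \o f.

Lemma iter_perturbation x k : (forall j, (0 < j <= k)%N -> ~ E (iter j f x)) ->
  iter k g x = iter k f x.
Proof.
elim: k => //= k IHk nE; rewrite {1}/g /= IHk.
  by rewrite tau_id// -iterS; apply: nE; rewrite leqnn.
by move=> j /andP[j0 jk]; apply: nE; rewrite j0 ltnW.
Qed.

(** Until the orbit comes back to [E] the maps f and g agree; the f-orbit of x first comes back at x
    itself, and there [tau] acts. *)
Lemma perturbation_return x : E x -> exists p, [/\ (0 < p)%N, iter p g x = tau x &
  forall j, (0 < j < p)%N -> ~ E (iter j g x)].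
Proof.
move=> Ex; pose Q k := (0 < k)%N && `[< E (iter k f x) >].
have exQ : exists k, Q k.
  have [[p p0 px] _] := Ex; exists p; rewrite /Q p0; apply/asboolP.
  by rewrite px.
have [[//|p] /andP[_ /asboolP Ep] minp] := ex_minnP exQ.
have nE j : (0 < j <= p)%N -> ~ E (iter j f x).
  move=> /andP[j0 jp] Ej; have := minp j; rewrite /Q j0 ltnNge jp.
  by move=> /(_ (introT (asboolP _) Ej)).
exists p.+1; split=> //.
- rewrite iterS iter_perturbation// /g /= -iterS.
  by rewrite (orbit_minima_unique Ex Ep).
- move=> j /andP[j0 jp]; rewrite iter_perturbation; first by apply: nE; rewrite j0.
  by move=> i /andP[i0 ij]; apply: nE; rewrite i0 (leq_trans ij).
Qed.

(** Strong induction on m: the orbit is cut at its first return to [E], which amounts to one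
    application of [tau]. *)
Lemma perturbation_iter m x : (0 < m)%N -> E x -> E (iter m g x) ->
  exists2 k, (0 < k)%N & iter m g x = iter k tau x.
Proof.
elim/ltn_ind: m x => m IHm x m0 Ex Em.
have [p [p0 px nE]] := perturbation_return Ex.
have [mp|] := ltnP m p; first by case: (nE m _ Em); rewrite m0.
rewrite leq_eqVlt => /predU1P[<-|pm]; first by exists 1%N.
have mE : iter m g x = iter (m - p) g (tau x) by rewrite -px -iterD subnK// ltnW.
have [||||k k0] := IHm (m - p)%N _ (tau x).
- by rewrite ltn_subrL p0.
- by rewrite subn_gt0.
- exact: tauE.
- by rewrite -mE.
- by rewrite -mE => ->; exists k.+1; rewrite ?iterSr.
Qed.

(** A g-orbit avoiding [E] is an f-orbit, and a periodic f-orbit meets [E]. So [E] is always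
    reached, and there a period of g gives a period of [tau]. *)
Lemma periodic_perturbation x : periodic_points g x ->
  exists i, (E `&` periodic_points tau) (iter i g x).
Proof.
move=> [m m0 mx]; have [[i Ei]|nE] := pselect (exists i, E (iter i g x)).
  exists i; split=> //; have mi : iter m g (iter i g x) = iter i g x.
    by rewrite -iterD addnC iterD mx.
  have [|k k0] := perturbation_iter m0 Ei; first by rewrite mi.
  by rewrite mi => ki; exists k.
have gf k : iter k g x = iter k f x.
  elim: k => //= k IHk; rewrite IHk {1}/g /= tau_id//.
  (* If f led into [E], so would g, because [tau] keeps [E] stable. *)
  apply: contra_notP nE => /contrapT Ek; exists k.+1.
  rewrite iterS IHk /g /=.
  exact: tauE.
have [|i Ei] := @orbit_minima_exists f x; first by exists m; rewrite // -gf.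
by case: nE; exists i; rewrite gf.
Qed.

End perturbation.
End periodic_orbits.

(** * Aperiodic perturbations of an automorphism *)

Section automorphisms.
Context {R : realType} {X : pmetricType R} (mu : probability (borel X) R).
Implicit Types (f g tau : automorphism mu) (A B : set (borel X)) (e : R).

Lemma aut_id_subproof A : measurable A -> measurable (id @` A).
Proof. by rewrite image_id. Qed.

Definition aut_id : automorphism mu :=
  Automorphism (inv_bij (fun=> erefl)) (@measurable_id _ _ setT) aut_id_subproof
    (fun _ _ => erefl).

Lemma aut_preimage f A : measurable A -> measurable (f @^-1` A).
Proof. by move=> mA; apply: measurable_preimage => //; exact: aut_meas. Qed.

Lemma aut_comp_meas_inv f g A : measurable A -> measurable ((f \o g) @` A).
Proof. by move=> mA; rewrite -image_comp; do 2 apply: aut_meas_inv. Qed.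

Lemma aut_comp_preserving f g A : measurable A -> mu ((f \o g) @^-1` A) = mu A.
Proof.
by move=> mA; rewrite comp_preimage !aut_preserving//; exact: aut_preimage.
Qed.

Definition aut_comp f g : automorphism mu :=
  Automorphism (bij_comp (aut_bij f) (aut_bij g))
    (measurableT_comp (aut_meas f) (aut_meas g))
    (@aut_comp_meas_inv f g) (@aut_comp_preserving f g).

Lemma aut_inj f : injective f. Proof. exact: bij_inj (aut_bij f). Qed.

(** If x in A were sent to a point outside A, that point would be fixed and share its image with x,
    against injectivity. *)
Lemma aut_stable f A : (forall x, ~ A x -> f x = x) ->
  forall x, A x -> A (f x).
Proof.
move=> fA x Ax; apply: contrapT => nAfx.
by have /aut_inj fx := fA _ nAfx; apply: nAfx; rewrite fx.
Qed.

Definition nudge e A : Prop := exists tau,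
  [/\ forall x, ~ A x -> tau x = x, forall x : X, mdist (tau x : X) x <= e &
      mu.-negligible (A `&` periodic_points tau)].

Lemma nudge0 e : 0 <= e -> nudge e set0.
Proof.
move=> e0; exists aut_id; split => // [x|]; first by rewrite mdistxx.
by rewrite set0I; exact: negligible_set0.
Qed.

(** Composing two automorphisms that move only points of disjoint sets leaves the orbits in each set
    unchanged. *)
Lemma nudgeU e A B : A `&` B = set0 -> nudge e A -> nudge e B ->
  nudge e (A `|` B).
Proof.
move=> AB0 [s [sA se sP]] [t [tB te tP]].
have AB x : A x -> ~ B x by move=> Ax Bx; have : (A `&` B) x by []; rewrite AB0.
have iterA x k : A x -> A (iter k (s \o t) x) /\ iter k (s \o t) x = iter k s x.
  move=> Ax; elim: k => //= k [Ak <-].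
  by rewrite tB; [split=> //; exact: aut_stable|exact: AB].
have BA x : B x -> ~ A x by move=> Bx /AB.
have iterB x k : B x -> B (iter k (s \o t) x) /\ iter k (s \o t) x = iter k t x.
  move=> Bx; elim: k => //= k [Bk <-]; have Bt := aut_stable tB Bk.
  by rewrite sA; [split|exact: BA].
exists (aut_comp s t); split => /=.
- move=> x /not_orP[nA nB]; rewrite tB//; exact: sA.
- move=> x; have [Ax|nAx] := pselect (A x); first by rewrite tB//; exact: AB.
  have [Bx|nBx] := pselect (B x); first by rewrite sA//; apply: BA; exact: aut_stable Bx.
  by rewrite tB.
- apply: negligibleS (negligibleU sP tP) => x [] [Ax|Bx] [k k0 kx]; [left|right];
    split=> //; exists k => //.
  + by have [_ <-] := iterA _ k Ax.
  + by have [_ <-] := iterB _ k Bx.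
Qed.

Hypothesis mu0 : atomless mu.

(** [atomless] asks for subsets of intermediate measure, while a singleton has only itself and the
    empty set. *)
Lemma atomless_subsingleton A : measurable A ->
  (forall x y, A x -> A y -> x = y) -> mu A = 0%E.
Proof.
move=> mA A1; apply/eqP; rewrite eq_le measure_ge0 andbT leNgt; apply/negP => A0.
have [B [mB BA B0]] := mu0 mA A0.
suff -> : B = A by rewrite ltxx.
apply/seteqP; split => // x Ax; apply: contrapT => nBx.
move: B0; rewrite (_ : B = set0) ?measure0 ?ltxx//; apply/seteqP; split => // y By.
by apply: nBx; rewrite (A1 x y)//; exact: BA.
Qed.

Variables (phi : borel X -> R) (psi : R -> borel X).
Hypotheses (mphi : measurable_fun setT phi) (mpsi : measurable_fun setT psi).
Hypothesis phiK : cancel phi psi.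

(** For the normalised measure on A, [phi] has an atomless law, so irrational rotations are
    available; rotating by 1 - a inverts rotating by a almost everywhere. *)
Lemma ae_aperiodic_on A : measurable A -> exists tau,
  (forall x, ~ A x -> tau x = x) /\ mu.-negligible (A `&` periodic_points tau).
Proof.
move=> mA; have [A0|A0] := eqVneq (mu A) 0%E.
  exists aut_id; split => //; exists A; split => //; exact: subIsetl.
pose muA : {measure set (borel X) -> \bar R} := mrestr mu mA.
pose P : probability (borel X) R := mnormalize muA mu.
have muAT : muA setT = mu A by rewrite /muA/= /mrestr setTI.
pose c := (fine (mu A))^-1.
have c0 : 0 < c.
  by rewrite invr_gt0 fine_gt0// lt0e A0 measure_ge0/= -ge0_fin_numE// fin_num_measure.
have PE B : P B = (muA B * c%:E)%E.
  rewrite /P/= /mnormalize muAT (negPf A0)/= ifF//.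
  by apply/negbTE; rewrite -ltey -ge0_fin_numE// fin_num_measure.
have muA_eq B D : P B = P D -> muA B = muA D.
  rewrite !PE => BD; apply/eqP; rewrite eq_le.
  by rewrite -(lee_pmul2r (x := c%:E))// -[in X in _ && X](lee_pmul2r (x := c%:E))// BD lexx.
have aeP (Q : borel X -> Prop) : {ae P, forall x, Q x} -> {ae muA, forall x, Q x}.
  move=> [N [mN N0 QN]]; exists N; split => //.
  by rewrite -(measure0 muA); apply: muA_eq; rewrite N0 measure0.
have phi0 s : P (phi @^-1` [set s]) = 0%E.
  have ms : measurable (phi @^-1` [set s]) by rewrite -[_ @^-1` _]setTI; exact: mphi.
  rewrite PE (_ : muA _ = 0%E) ?mul0e//; apply: atomless_subsingleton.
    exact: measurableI.
  by move=> x y [/= <- _] [/(can_inj phiK) -> _].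
(* Irrational because pi is, and below 1 because pi / 2 < 2. *)
pose a : R := pi / 4.
have a01 : 0 < a < 1.
  by have /andP[] := @pihalf_02 R; rewrite /a => ? ?; apply/andP; split; lra.
have a01' : 0 < 1 - a < 1 by case/andP: a01 => ? ?; apply/andP; split; lra.
have a_irr : irrational a.
  move=> /rationalP[p [q pq]]; apply: (@pi_irrationnal R); apply/rationalP.
  by exists (p * 4), q; rewrite intrM mulrAC -pq /a divfK.
have mS b := measurable_rotated P mphi mpsi b.
have pS b : 0 < b < 1 -> preserving muA (rotated P psi mphi b).
  by move=> b01 B mB; apply: muA_eq; exact: preserving_rotated.
have S'K : {ae muA, forall x, rotated P psi mphi a (rotated P psi mphi (1 - a) x) = x}.
  apply: aeP; have := rotatedK mphi mpsi phiK phi0 a01'; by rewrite subKr.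
have [tau [tauA taua]] := automorphism_of_ae_inverses mphi (can_inj phiK)
  (mS a) (mS (1 - a)) (pS _ a01) (pS _ a01')
  (aeP _ (rotatedK mphi mpsi phiK phi0 a01)) S'K.
exists tau; split => //.
have : {ae muA, forall x, ~ periodic_points tau x}.
  apply: filterS2 taua (aeP _ (rotated_aperiodic mphi mpsi phiK phi0 a01 a_irr)).
  by move=> x tx ax [k k0]; rewrite tx; exact: ax.
move=> [N [mN N0 PN]]; exists (A `&` N); split.
- exact: measurableI.
- by rewrite setIC.
- by move=> x [Ax Px]; split => //; apply: PN => /=; apply.
Qed.

Lemma nudge_small e A : measurable A -> 0 <= e ->
  (forall x y : X, A x -> A y -> mdist x y <= e) -> nudge e A.
Proof.
move=> mA e0 Ae; have [tau [tauA tauP]] := ae_aperiodic_on mA.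
exists tau; split => // x; have [Ax|nAx] := pselect (A x).
  by apply: Ae => //; exact: aut_stable.
by rewrite tauA// mdistxx.
Qed.

(** Balls of radius e / 2 around a finite net have diameter at most e; they are peeled off A one
    after another. *)
Lemma nudge_measurable e A : compact [set: X] -> measurable A -> 0 < e -> nudge e A.
Proof.
move=> cX mA e0; have [|s sP] := compact_finite_net (e := e / 2) cX.
  by rewrite divr_gt0.
(* Only the points of A have to be near s, so that the induction hypothesis applies once a ball is
   removed from A. *)
have : forall x, A x -> exists2 y : X, y \in s & mdist y x < e / 2 by move=> x _.
elim: s A mA {sP} => [|z s IHs] A mA sP.
  rewrite (_ : A = set0); first exact/nudge0/ltW.
  by apply/seteqP; split => // x /sP[].
pose B : set (borel X) := [set x | mdist z x < e / 2].
have mB : measurable B by apply: sub_sigma_algebra; exact: open_ball_mdist.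
rewrite -(setDUK (@subIsetl _ A B)); apply: nudgeU.
- by apply/seteqP; split => // x [ABx [_ /(_ ABx)]].
- apply: nudge_small; [exact: measurableI|exact: ltW|].
  move=> x y [_ zx] [_ zy]; have {}zx : mdist x z < e / 2 by rewrite metric_sym.
  have {}zy : mdist z y < e / 2 by [].
  by have := metric_triangle x z y; lra.
- apply: IHs; first by apply: measurableD => //; exact: measurableI.
  move=> x [Ax nBx]; have [y] := sP x Ax; rewrite inE => /predU1P[->|ys] yx.
    by case: nBx; split.
  by exists y.
Qed.

Lemma measurable_orbit_minima f : measurable (orbit_minima phi f).
Proof.
apply: measurableI.
  rewrite [X in measurable X](_ : _ = [set x | exists k, (0 < k)%N /\ iter k f x = x]).
    apply: measurable_exists => k; apply: measurableI; first exact: measurable_Prop.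
    apply: (measurable_equalizer mphi (can_inj phiK)) => //.
    exact: (measurable_iter k (aut_meas _)).
  apply/seteqP; split => x [k]; first by exists k.
  by move=> [k0 kx]; exists k.
apply: measurable_forall => k.
have mk : measurable_fun setT (phi \o iter k f).
  by apply: measurableT_comp => //; exact: (measurable_iter k (aut_meas _)).
have := measurable_funB mk mphi measurableT (measurable_itv `[0, +oo[).
rewrite setTI; congr measurable; apply/seteqP; split => x /=;
  by rewrite in_itv/= andbT subr_ge0.
Qed.

Lemma aperiodic_perturbation e f : compact [set: X] -> 0 < e -> exists g,
  (forall x, mdist (f x : X) (g x) <= e) /\ mu.-negligible (periodic_points g).
Proof.
move=> cX e0.
have [tau [tauE taue tauP]] := nudge_measurable cX (measurable_orbit_minima f) e0.
exists (aut_comp tau f); split => [x|]; first by rewrite metric_sym; exact: (taue (f x)).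
set g := aut_comp tau f.
have [N [mN N0 EN]] := tauP.
(* Every periodic g-orbit passes through the null set of periodic points of [tau] among the orbit
   minima. *)
apply: (@negligibleS _ _ _ _ (\bigcup_k (iter k g) @^-1` N)).
  move=> x gx.
  have [k] := periodic_perturbation (can_inj phiK) (aut_stable tauE) tauE gx.
  by move=> /EN Nk; exists k.
apply: negligible_bigcup => k; exists (iter k g @^-1` N); split => //.
  by apply: measurable_preimage => //; exact: (measurable_iter k (aut_meas _)).
rewrite [LHS](_ : _ = mu N)//; apply: preserving_iter => //; first exact: aut_meas.
exact: aut_preserving.
Qed.

End automorphisms.

(** * Weak continuity of preimages *)

Section measurable_distance.
Context {R : realType} {X : pmetricType R}.

Lemma measurable_mdist (q : X) : measurable_fun setT (fun y : borel X => mdist q y).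
Proof.
apply: (measurability _ (RGenInftyO.measurableE R)) => //.
move=> _ [_ [r ->] <-]; rewrite setTI; apply: sub_sigma_algebra.
rewrite (_ : _ @^-1` _ = [set y | mdist q y < r]); first exact: open_ball_mdist.
by apply/seteqP; split => y /=; rewrite in_itv.
Qed.

(** The distance between two points is the supremum, over the countable net, of the differences of
    their distances to a net point; each difference is measurable. *)
Lemma measurable_mdist_gt d (T : measurableType d) (f g : T -> borel X) (a : R) :
  compact [set: X] -> measurable_fun setT f -> measurable_fun setT g ->
  measurable [set x | a < mdist (f x : X) (g x)].
Proof.
move=> cX mf mg; have [q qP] := compact_net cX.
rewrite (_ : [set x | _] = [set x | exists k j,
    a < mdist (q k j) (f x) - mdist (q k j) (g x)]); last first.
  apply/seteqP; split => x /=; last first.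
    by move=> [k [j]]; have := metric_triangle (q k j) (g x : X) (f x);
      rewrite (metric_sym (g x : X)); lra.
  move=> afg; have [k ke] : exists k, rad k < (mdist (f x : X) (g x) - a) / 2.
    by apply: rad_lt; rewrite divr_gt0// subr_gt0.
  have [j qg] := qP k (g x); exists k, j.
  have := metric_triangle (f x : X) (q k j) (g x).
  by rewrite (metric_sym (f x : X) (q k j)); lra.
apply: measurable_exists => k; apply: measurable_exists => j.
have mq (h : T -> borel X) p : measurable_fun setT h ->
    measurable_fun setT (fun x => mdist p (h x)).
  by move=> mh; exact: (measurableT_comp (measurable_mdist p) mh).
have := measurable_funB (mq _ (q k j) mf) (mq _ (q k j) mg) measurableT (measurable_itv `]a, +oo[).
rewrite setTI; congr measurable; apply/seteqP; split => x /=;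
  by rewrite in_itv/= andbT.
Qed.

End measurable_distance.

Section weak_neighborhoods.
Context {R : realType} {X : pmetricType R} (mu : probability (borel X) R).
Hypothesis cX : compact [set: X].
Implicit Types (f g : automorphism mu) (A B : set (borel X)) (e : R).
Local Open Scope ereal_scope.

Lemma measurable_aut_gt f g e : measurable [set x | e < mdist (f x : X) (g x)]%R.
Proof. by apply: measurable_mdist_gt => //; exact: aut_meas. Qed.

(** Neighbourhoods are taken among automorphisms, not their classes, with e as both threshold and
    bound, as in [weak_dist]. *)
Definition weak_near f (Q : automorphism mu -> Prop) : Prop :=
  exists2 e, (0 < e)%R & forall g,
    mu [set x | e < mdist (f x : X) (g x)]%R < e%:E -> Q g.

Lemma weak_near_le f e e' g : (e <= e')%R ->
  mu [set x | e < mdist (f x : X) (g x)]%R < e%:E ->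
  mu [set x | e' < mdist (f x : X) (g x)]%R < e'%:E.
Proof.
move=> ee' fge; apply: le_lt_trans (lt_le_trans fge _); last by rewrite lee_fin.
apply: le_measure; try (by apply: mem_set; exact: measurable_aut_gt).
by move=> x /=; exact: le_lt_trans.
Qed.

Lemma weak_nearI f Q Q' : weak_near f Q -> weak_near f Q' ->
  weak_near f (fun g => Q g /\ Q' g).
Proof.
move=> [e e0 eQ] [e' e'0 eQ']; exists (Num.min e e'); first by rewrite lt_min e0.
move=> g fg; split; [apply: eQ|apply: eQ']; apply: weak_near_le fg;
  by rewrite ge_min lexx ?orbT.
Qed.

Lemma weak_nearS f (Q Q' : automorphism mu -> Prop) : (forall g, Q g -> Q' g) ->
  weak_near f Q -> weak_near f Q'.
Proof. by move=> QQ' [e e0 eQ]; exists e => // g /eQ /QQ'. Qed.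

Lemma weak_near_bigU f (D : nat -> automorphism mu -> set (borel X)) :
  (forall i g, measurable (D i g)) ->
  (forall i e, (0 < e)%R -> weak_near f (fun g => mu (D i g) <= e%:E)) ->
  forall N e, (0 < e)%R ->
    weak_near f (fun g => mu [set x | exists i, (i < N)%N /\ D i g x] <= e%:E).
Proof.
move=> mD nD; elim=> [|N IHN] e e0.
  exists 1%R => // g _; rewrite (_ : [set x | _] = set0).
    by rewrite measure0 lee_fin ltW.
  by apply/seteqP; split => // x [i []].
have mDN g : measurable [set x | exists i, (i < N)%N /\ D i g x].
  by apply: measurable_exists => i; apply: measurableI => //; exact: measurable_Prop.
have e20 : (0 < e / 2)%R by rewrite divr_gt0.
apply: weak_nearS (weak_nearI (IHN _ e20) (nD N _ e20)) => g [gN gD].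
rewrite (_ : [set x | _] = [set x | exists i, (i < N)%N /\ D i g x] `|` D N g).
  rewrite (le_trans (measureU2 _ _ _))// (splitr e) EFinD; exact: leeD.
apply/seteqP; split => x /=.
  move=> [i []]; rewrite ltnS leq_eqVlt => /predU1P[->|iN] Dx; [by right|left].
  by exists i.
case=> [[i [iN Dx]]|Dx]; last by exists N.
by exists i; split => //; exact: ltnW.
Qed.

Lemma exhaustion (F : nat -> set (borel X)) A e : (0 < e)%R -> measurable A ->
  (forall k, measurable (F k)) -> (forall i j, (i <= j)%N -> F i `<=` F j) ->
  A `<=` \bigcup_k F k -> exists N, mu (A `\` F N) < e%:E.
Proof.
move=> e0 mA mF ndF AF.
have mAF k : measurable (A `\` F k) by exact: measurableD.
have : mu \o (fun k => A `\` F k) @ \oo --> 0.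
  rewrite -(measure0 mu) (_ : set0 = \bigcap_k (A `\` F k)).
    apply: nonincreasing_cvg_mu => //.
    - by rewrite -ge0_fin_numE// fin_num_measure.
    - exact: bigcapT_measurable.
    - by move=> i j ij; apply/subsetPset; apply: setDS; exact: ndF.
  apply/esym/seteqP; split => // x AFx; have [Ax _] := AFx 0%N I.
  by have [k _ Fx] := AF x Ax; have [_ /(_ Fx)] := AFx k I.
move=> /fine_cvg /cvgr_lt /(_ e e0) /filter_ex[N /= Ne]; exists N.
by rewrite -[X in X < _]fineK ?fin_num_measure// lte_fin.
Qed.

(** One half of the symmetric difference is enough: both preimages have measure [mu A], so the two
    halves have equal measure. *)
Definition weak_continuity_set f A : Prop := measurable A /\
  forall e, (0 < e)%R -> weak_near f (fun g => mu (f @^-1` A `\` g @^-1` A) <= e%:E).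

(** If [f x] is at distance at least [rad k] from the complement of U and [g x] is outside U, then f
    and g differ at x by at least [rad k], which is rare. The rest of U is small for large k. *)
Lemma weak_continuity_open f (U : set X) : open U -> weak_continuity_set f U.
Proof.
move=> oU; have mU : measurable (U : set (borel X)) by exact: sub_sigma_algebra.
split => // e e0.
pose F k : set (borel X) := [set y : X | forall z, ~ U z -> (rad k <= mdist z y)%R].
have mF k : measurable (F k).
  rewrite (_ : F k = ~` \bigcup_(z in ~` U) [set y | (mdist z y < rad k)%R]).
    apply: measurableC; apply: sub_sigma_algebra; apply: bigcup_open => z _.
    exact: open_ball_mdist.
  apply/seteqP; split => y /=; first by move=> Fy [z nUz /=]; rewrite ltNge Fy.
  by move=> nF z nUz; rewrite leNgt; apply/negP => zy; apply: nF; exists z.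
have [|i j ij y Fy z nUz|y Uy|k kU] := @exhaustion F U (e / 2) _ mU mF.
- by rewrite divr_gt0.
- by rewrite (le_trans _ (Fy z nUz))//; exact: rad_le.
- have [r r0 rU] := open_mdist oU Uy; have [k kr] := rad_lt r0.
  exists k => // z nUz; rewrite leNgt metric_sym; apply/negP => zy.
  by apply: nUz; apply: rU; rewrite (lt_trans zy).
(* Halving [rad k] turns a distance of at least [rad k] into one strictly above r; e / 2 bounds the
   measure where this happens. *)
pose r : R := (Num.min (e / 2) (rad k / 2))%R.
exists r; first by rewrite lt_min !divr_gt0// rad_gt0.
move=> g fg; apply: (@le_trans _ _
  (mu (f @^-1` (U `\` F k) `|` [set x | r < mdist (f x : X) (g x)]%R))).
  apply: le_measure.
  - by apply/mem_set/measurableD; exact: aut_preimage.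
  - apply/mem_set/measurableU; last exact: measurable_aut_gt.
    by apply: aut_preimage; exact: measurableD.
  - move=> x [Ufx nUgx]; have [Fx|nFx] := pselect (F k (f x)); [right|left] => //=.
    rewrite (lt_le_trans _ (_ : rad k <= _)%R)//.
      by rewrite gt_min; apply/orP; right; have := rad_gt0 (R := R) k; lra.
    by rewrite metric_sym; exact: Fx.
rewrite (le_trans (measureU2 _ _ _))//.
- by apply: aut_preimage; exact: measurableD.
- exact: measurable_aut_gt.
rewrite (splitr e) EFinD; apply: leeD.
  by rewrite [leLHS](aut_preserving f (measurableD mU (mF k))) ltW.
by rewrite (le_trans (ltW fg))// lee_fin ge_min lexx.
Qed.

Lemma weak_continuity_setC f A : weak_continuity_set f A ->
  weak_continuity_set f (~` A).
Proof.
move=> [mA cA]; split => [|e e0]; first exact: measurableC.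
apply: weak_nearS (cA e e0) => g; congr (_ <= _).
have mf := aut_preimage f mA; have mg := aut_preimage g mA.
rewrite (_ : f @^-1` (~` A) `\` _ = g @^-1` A `\` f @^-1` A).
  have fin B : measurable B -> mu B < +oo by move=> mB; rewrite -ge0_fin_numE// fin_num_measure.
  rewrite !measureD ?fin//; congr (_ - _); last by rewrite setIC.
  by rewrite [LHS](aut_preserving f mA) [RHS](aut_preserving g mA).
by apply/seteqP; split => x /= [Af Ag]; split => //; exact: contrapT.
Qed.

(** Finitely many of the sets fill the union up to measure e / 2, and they impose only finitely many
    conditions on g. *)
Lemma weak_continuity_bigcup f (A : nat -> set (borel X)) :
  (forall k, weak_continuity_set f (A k)) -> weak_continuity_set f (\bigcup_k A k).
Proof.
move=> cA; have mA k : measurable (A k) := (cA k).1.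
have mU : measurable (\bigcup_k A k) by exact: bigcupT_measurable.
split => // e e0; have e20 : (0 < e / 2)%R by rewrite divr_gt0.
pose F N := [set x | exists i, (i < N)%N /\ A i x].
have mF N : measurable (F N).
  by apply: measurable_exists => i; apply: measurableI => //; exact: measurable_Prop.
have [i j ij x [k [ki Ax]]|x [k _ Ax]|N NU] := exhaustion e20 mU mF.
- by exists k; split => //; exact: leq_trans ij.
- by exists k.+1 => //; exists k.
pose D i g := f @^-1` A i `\` g @^-1` A i.
have mD i g : measurable (D i g) by apply: measurableD; exact: aut_preimage.
have := weak_near_bigU (f := f) mD (fun i => (cA i).2) N e20.
apply: weak_nearS => g gN.
pose DN := [set x | exists i, (i < N)%N /\ D i g x].
have mDN : measurable DN.
  by apply: measurable_exists => i; apply: measurableI => //; exact: measurable_Prop.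
have mfU : measurable (f @^-1` (\bigcup_k A k `\` F N)).
  by apply: aut_preimage; exact: measurableD.
apply: (@le_trans _ _ (mu (f @^-1` (\bigcup_k A k `\` F N) `|` DN))).
  apply: le_measure.
  - by apply/mem_set/measurableD; exact: aut_preimage.
  - exact/mem_set/measurableU.
  - move=> x [Uf nUg]; have [[i [iN Ai]]|nF] := pselect (F N (f x)); last by left.
    right; exists i; split => //; split => // Ag; apply: nUg; by exists i.
rewrite (le_trans (measureU2 _ _ _))// (splitr e) EFinD; apply: leeD => //.
by rewrite [leLHS](aut_preserving f (measurableD mU (mF N))) ltW.
Qed.

Lemma weak_continuity f A : measurable A -> weak_continuity_set f A.
Proof.
suff : measurable `<=` weak_continuity_set f by exact.
apply: smallest_sub; last by move=> U; exact: weak_continuity_open.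
split.
- exact/weak_continuity_open/open0.
- by move=> B; rewrite setTD; exact: weak_continuity_setC.
- exact: weak_continuity_bigcup.
Qed.

(** Replace f by g first in the k inner factors, by induction applied to the preimage of A under f,
    then in the outer factor, an error pulled back by [iter k g], which preserves [mu]. *)
Lemma weak_continuity_iter f k A e : measurable A -> (0 < e)%R ->
  weak_near f (fun g => mu (iter k f @^-1` A `\` iter k g @^-1` A) <= e%:E).
Proof.
have mk B h j : measurable B -> measurable (iter j (h : automorphism mu) @^-1` B).
  by move=> mB; apply: measurable_preimage => //; exact: (measurable_iter j (aut_meas h)).
move=> mA; elim: k e => [|k IHk] e in A mA *; move=> e0.
  by exists 1%R => // g _; rewrite setDv measure0 lee_fin ltW.
have e20 : (0 < e / 2)%R by rewrite divr_gt0.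
have mfA := aut_preimage f mA.
have := weak_nearI (IHk (e / 2)%R _ mfA e20) ((weak_continuity f mA).2 _ e20).
apply: weak_nearS => g [gk g1]; have mgA := aut_preimage g mA.
pose D := iter k f @^-1` (f @^-1` A) `\` iter k g @^-1` (f @^-1` A).
pose D' := iter k g @^-1` (f @^-1` A `\` g @^-1` A).
have mD : measurable D by apply: measurableD; exact: mk.
have mD' : measurable D' by apply: mk; exact: measurableD.
apply: (@le_trans _ _ (mu (D `|` D'))).
  apply: le_measure.
  - by apply/mem_set/measurableD; exact: mk.
  - exact/mem_set/measurableU.
  - move=> x [/= Af nAg]; have [Afg|nAfg] := pselect (A (f (iter k g x))).
      by right.
    by left.
rewrite (le_trans (measureU2 _ mD mD'))// (splitr e) EFinD; apply: leeD => //.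
rewrite [leLHS](_ : _ = mu (f @^-1` A `\` g @^-1` A))//.
apply: preserving_iter; [exact: aut_meas|exact: aut_preserving|exact: measurableD].
Qed.

End weak_neighborhoods.

(** * The weak topology *)

Section fixed_points.
Context {R : realType} {X : pmetricType R} (mu : probability (borel X) R).
Hypothesis cX : compact [set: X].
Implicit Types f g : automorphism mu.
Local Open Scope ereal_scope.

Lemma separating_sequence : exists B : nat -> set (borel X),
  (forall i, measurable (B i)) /\ forall x y, x <> y -> exists i, B i x /\ ~ B i y.
Proof.
have [q qP] := compact_net cX.
pose B (i : nat) : set (borel X) :=
  if (choice.unpickle i : option (nat * nat)) is Some (k, j)
  then [set y : X | mdist (q k j) y < rad k]%R else set0.
exists B; split => [i|x y xy].
  rewrite /B; case: choice.unpickle => [[k j]|]; last exact: measurable0.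
  by apply: sub_sigma_algebra; exact: open_ball_mdist.
have d0 : (0 < mdist (x : X) y)%R by rewrite mdist_gt0; apply/eqP.
have [k kd] : exists k, (rad k < mdist (x : X) y / 2)%R.
  by apply: rad_lt; rewrite divr_gt0.
have [j qx] := qP k x; exists (choice.pickle (k, j)).
rewrite /B choice.pickleK; split => //= qy.
have := metric_triangle (x : X) (q k j) y.
by rewrite (metric_sym (x : X) (q k j)); lra.
Qed.

(** Up to small measure, the points moved by f^k are detected by finitely many sets [B i] containing
    the point but not its image. By weak continuity g^k moves most of them out of [B i] too. *)
Lemma weak_near_fixed f k e : (forall g, measurable [set x | iter k g x = x]) ->
  mu [set x | iter k f x = x] < e%:E ->
  weak_near f (fun g => mu [set x | iter k g x = x] < e%:E).
Proof.
set Fix := fun h : automorphism mu => [set x | iter k h x = x].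
move=> mFix fe; have [B [mB sepB]] := separating_sequence.
have mpre g A : measurable A -> measurable (iter k g @^-1` A).
  by move=> mA; apply: measurable_preimage => //; exact: (measurable_iter k (aut_meas g)).
pose c := fine (mu (Fix f)).
have cE : mu (Fix f) = c%:E by rewrite fineK// fin_num_measure//; exact: mFix.
(* One third for the undetected points, one for the weak error; the last keeps the inequality
   strict. *)
have ce : (0 < (e - c) / 3)%R by rewrite divr_gt0// subr_gt0 -lte_fin -cE.
pose W N := [set x | exists i, (i < N)%N /\ (B i `\` iter k f @^-1` B i) x].
have mW N : measurable (W N).
  apply: measurable_exists => i; apply: measurableI; first exact: measurable_Prop.
  by apply: measurableD => //; exact: mpre.
have [i j ij x [l [li Bx]]|x nFx|N NW] := exhaustion mu ce (measurableC (mFix f)) mW.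
- by exists l; split => //; exact: leq_trans ij.
- have [i [Bi nBi]] : exists i, B i x /\ ~ B i (iter k f x).
    by apply: sepB => xf; apply: nFx; rewrite /= -xf.
  by exists i.+1 => //; exists i.
(* Complements, because a detected point fixed by g^k stays in [B i] while f^k sends it out. *)
pose D i g := iter k f @^-1` (~` B i) `\` iter k g @^-1` (~` B i).
have mD i g : measurable (D i g) by apply: measurableD; apply: mpre; exact: measurableC.
have nD i e' : (0 < e')%R -> weak_near f (fun g => mu (D i g) <= e'%:E).
  by apply: weak_continuity_iter => //; exact: measurableC.
apply: weak_nearS (weak_near_bigU cX mD nD N ce) => g gN.
pose DN := [set x | exists i, (i < N)%N /\ D i g x].
have mDN : measurable DN.
  by apply: measurable_exists => i; apply: measurableI => //; exact: measurable_Prop.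
have mFW : measurable (~` Fix f `\` W N).
  by apply: measurableD => //; apply: measurableC; exact: mFix.
apply: (@le_lt_trans _ _ (mu (Fix f `|` ((~` Fix f `\` W N) `|` DN)))).
  apply: le_measure.
  - by apply: mem_set; exact: mFix.
  - by apply/mem_set/measurableU; [exact: mFix|exact: measurableU].
  - move=> x /= gx; have [|nf] := pselect (Fix f x); [by left|right].
    have [[i [iN [Bi nBi]]]|nW] := pselect (W N x); [right|by left].
    by exists i; split => //; split => //=; rewrite gx.
rewrite (le_lt_trans (measureU2 _ (mFix f) (measurableU _ _ mFW mDN)))//.
rewrite (@le_lt_trans _ _ (c%:E + (((e - c) / 3)%:E + ((e - c) / 3)%:E)))//.
  apply: leeD; first by rewrite [leLHS]cE.
  by rewrite (le_trans (measureU2 _ mFW mDN))//; apply: leeD => //; exact: ltW.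
by rewrite -!EFinD lte_fin; lra.
Qed.

End fixed_points.

Section weak_topology.
Context {R : realType} {X : pmetricType R} (mu : probability (borel X) R).
Hypothesis cX : compact [set: X].
Implicit Types f g : Auto mu.

Lemma weak_dist_lt f g e : weak_dist f g < e ->
  (mu [set x | e < mdist (repr f x : X) (repr g x)]%R < e%:E)%E.
Proof.
move=> /inf_lt; case=> [|a /= fga ae]; last exact: (weak_near_le cX (ltW ae) fga).
(* Any number above 1 belongs to the set, [mu] being a probability; so the infimum is not that of an
   empty set. *)
exists 2 => /=; rewrite (@le_lt_trans _ _ 1%E) ?lte_fin ?ltr1n//.
by apply: probability_le1; exact: measurable_aut_gt.
Qed.

Lemma weak_dist_le f g e : 0 < e ->
  {ae mu, forall x, mdist (repr f x : X) (repr g x) <= e} -> weak_dist f g <= e.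
Proof.
move=> e0 fg; apply: ge_inf.
  exists 0 => a /= fga; have : (0 < a%:E)%E := le_lt_trans (measure_ge0 _ _) fga.
  by rewrite lte_fin => /ltW.
rewrite /= [X in (X < _)%E](_ : _ = 0%E) ?lte_fin//.
apply/negligibleP; first exact: measurable_aut_gt.
by apply: negligibleS fg => x /=; rewrite ltNge => /negP.
Qed.

Lemma weak_near_open (Q : automorphism mu -> Prop) :
  (forall f : automorphism mu, Q f -> weak_near f Q) -> open [set f : Auto mu | Q (repr f)].
Proof.
move=> nQ; suff : weak_open [set f : Auto mu | Q (repr f)] by [].
move=> f /= /nQ[e e0 eQ]; exists e => // g /weak_dist_lt; exact: eQ.
Qed.

Lemma ae_repr_pi (g : automorphism mu) :
  {ae mu, forall x, repr (\pi_(Auto mu)%qT g) x = g x}.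
Proof.
have : (repr (\pi_(Auto mu)%qT g) = g %[mod Auto mu])%qT by rewrite reprK.
by move/eqquotP => /asboolP.
Qed.

End weak_topology.

(** * Density and the G_delta property *)

Section aperiodic_automorphisms.
Context {R : realType} {X : pmetricType R} (mu : probability (borel X) R).
Hypotheses (cX : compact [set: X]) (mu0 : atomless mu).

(** Invariance of [mu] extends the almost everywhere agreement to all iterates. This lets
    [aperiodic], stated on a chosen representative, be checked on another one. *)
Lemma negligible_periodic_ae (f g : automorphism mu) :
  {ae mu, forall x, f x = g x} -> mu.-negligible (periodic_points g) ->
  mu.-negligible (periodic_points f).
Proof.
move=> fg Pg; have [N [mN N0 nfg]] : {ae mu, forall x, forall k, iter k f x = iter k g x}.
  apply: filterS (preserving_ae_iter (aut_meas g) (@aut_preserving _ _ _ g) fg).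
  by move=> x fgx; elim=> //= k ->.
apply: negligibleS (negligibleU Pg (_ : mu.-negligible N)); last by exists N; split.
move=> x [k k0 fx]; have [fgx|] := pselect (forall k, iter k f x = iter k g x).
  by left; exists k => //; rewrite -fgx.
by right; exact: nfg.
Qed.

Lemma dense_aperiodic : dense [set f : Auto mu | aperiodic f].
Proof.
move=> O [f Of] oO; have /(_ f Of)[e e0 eO] : weak_open O by [].
have [phi [psi [mphi mpsi phiK]]] := standard_coding cX.
(* Half of e, because a bound on the displacement gives only a non-strict bound on the weak
   distance. *)
have [|g [fg Pg]] := aperiodic_perturbation mu0 mphi mpsi phiK (e := e / 2) (repr f) cX.
  by rewrite divr_gt0.
exists (\pi_(Auto mu)%qT g); split.
  apply: eO; apply: (@le_lt_trans _ _ (e / 2)); last by rewrite ltr_pdivrMr// ltr_pMr// ltr1n.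
  apply: weak_dist_le => //; first by rewrite divr_gt0.
  by apply: filterS (ae_repr_pi g) => x ->; exact: fg.
exact: negligible_periodic_ae (ae_repr_pi g) Pg.
Qed.

Lemma Gdelta_aperiodic : Gdelta [set f : Auto mu | aperiodic f].
Proof.
have [phi [psi [mphi mpsi phiK]]] := standard_coding cX.
have mFix k (f : automorphism mu) : measurable [set x | iter k f x = x].
  apply: (measurable_equalizer mphi (can_inj phiK)) => //.
  exact: (measurable_iter k (aut_meas f)).
(* The shift to k + 1 excludes the power 0, which fixes every point. *)
pose V k m := [set f : Auto mu |
  (mu [set x | iter k.+1 (repr f) x = x] < (rad m)%:E :> \bar R)%E].
(* A single sequence enumerates the pairs; an index coding no pair contributes the whole space. *)
exists (fun i => if (choice.unpickle i : option (nat * nat)) is Some (k, m)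
  then V k m else setT) => [i|].
  case: choice.unpickle => [[k m]|]; last exact: openT.
  apply: (@weak_near_open _ _ mu cX
    (fun h => (mu [set x | iter k.+1 h x = x] < (rad m)%:E)%E)) => h.
  exact: weak_near_fixed.
apply/seteqP; split => f.
  move=> Pf i _; case: choice.unpickle => [[k m]|//].
  rewrite /V /= (_ : mu _ = 0%E) ?lte_fin ?rad_gt0//.
  apply/negligibleP; first exact: (mFix k.+1).
  by apply: negligibleS Pf => x; exists k.+1.
move=> Vf; apply: (@negligibleS _ _ _ _
    (\bigcup_k [set x | iter k.+1 (repr f) x = x])).
  by move=> x [[//|k] _ kx]; exists k.
apply: negligible_bigcup => k; apply/negligibleP; first exact: (mFix k.+1).
apply/eqP; rewrite eq_le measure_ge0 andbT leNgt; apply/negP => k0.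
have [m mk] : exists m, rad m < fine (mu [set x | iter k.+1 (repr f) x = x]).
  by apply: rad_lt; rewrite fine_gt0// k0 -ge0_fin_numE// fin_num_measure//; exact: (mFix k.+1).
have Vm : (mu [set x | iter k.+1 (repr f) x = x] < (rad m)%:E)%E.
  by have := Vf (choice.pickle (k, m)) I; rewrite choice.pickleK.
move: Vm; apply/negP; rewrite -leNgt -[leRHS]fineK; first by rewrite lee_fin ltW.
rewrite fin_num_measure//; exact: (mFix k.+1).
Qed.

End aperiodic_automorphisms.

Theorem proposition6p8 (R : realType) (n : nat) (X : pmetricType R)
    (M : smooth_manifold R n X) (g : riemannian_metric M)
    (mu : probability (borel X) R) :
  (2 <= n)%N ->
  compact [set: X] ->
  connected [set: X] ->
  (forall x y : X, (mdist x y)%:E = riemannian_dist g x y) ->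
  good_measure M mu ->
  dense [set f : Auto mu | aperiodic f] /\
  Gdelta [set f : Auto mu | aperiodic f].
Proof.
move=> _ cX _ _ [mu0 _ _].
by split; [exact: dense_aperiodic|exact: Gdelta_aperiodic].
Qed.
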